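(* Let $X$ be a finite connected CW complex of dimension $d\ge1$, $z_0\in Z_{d-1}(X;\mathbb Z)$, $\beta>0$, and let $\gamma\colon\mathbb R\to\mathcal M_X$ be a smooth $1$-periodic map, $\gamma(t)=(E(t),W(t))$. There exists a positive real number $\tau_0=\tau_0(\beta,\gamma)$ such that for all $\tau_D>\tau_0$ there exists a unique $1$-periodic solution $\rho_{\tau_D}$, with values in the real $(d-1)$-cycles representing the homology class $[z_0]\in H_{d-1}(X;\mathbb R)$, of the dynamical equation $$\dot q=-\tau_D H(t)\,q,\qquad H(t)=\partial\, e^{-\beta W(t)}\,\partial^*\, e^{\beta E(t)}.$$ Furthermore, $$\lim_{\tau_D\to\infty}\rho_{\tau_D}(t)=\rho^B(t)\qquad\text{for all }t,$$ where $\rho^B(t)$ is the Boltzmann distribution at $[z_0]$ for the weights $E(t)$ and inverse temperature $\beta$.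
   Context: **Chains.** $X_k$ is the set of (oriented) $k$-cells of $X$, $X^{(k)}$ its $k$-skeleton; $C_k(X;A)$ is the cellular chain module (free on $X_k$) with boundary $\partial$; $Z_k$, $B_k$ are cycles and boundaries. $\partial^*$ is the adjoint of $\partial$ for the inner products in which the cells are orthonormal. $\beta_k(Y)$ is the $k$-th Betti number of $Y$. **Parameters.** $\mathcal M_X$ is the real vector space of pairs $(E,W)$ of functions $E\colon X_{d-1}\to\mathbb R$, $W\colon X_d\to\mathbb R$. $e^{\beta E}$ and $e^{\beta W}$ are the diagonal operators $j\mapsto e^{\beta E_j}j$ on $C_{d-1}(X;\mathbb R)$ and $\alpha\mapsto e^{\beta W_\alpha}\alpha$ on $C_d(X;\mathbb R)$. **Spanning co-trees.** A spanning co-tree of $X$ is a subcomplex $L$ with $X^{(d-2)}\subset L\subset X^{(d-1)}$ such that the inclusion induces an isomorphism $H_{d-1}(L;\mathbb Q)\to H_{d-1}(X;\mathbb Q)$ and $\beta_{d-2}(L)=\beta_{d-2}(X)$. Let $a_L$ be the order of the finite group $H_{d-1}(X,L;\mathbb Z)$, and let $\psi_L\colon H_{d-1}(X;\mathbb Q)\to Z_{d-1}(X;\mathbb Q)$ send a class to its unique representative cycle lying in $Z_{d-1}(L;\mathbb Q)$. **Boltzmann distribution.** With $b_L=a_L^2\prod_{b\in L_{d-1}}e^{-\beta E_b}$ and $\nabla=\sum_Lb_L$ (sum over all spanning co-trees), the Boltzmann distribution at $x\in H_{d-1}(X;\mathbb Z)$ is $\rho^B(x)=\frac1\nabla\sum_Lb_L\,\psi_L(\bar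 x)\in Z_{d-1}(X;\mathbb R)$, where $\bar x$ is the image of $x$ in $H_{d-1}(X;\mathbb Q)$. *)

(* Defs.v *)
From HB Require Import structures.
From mathcomp Require Export all_boot all_order all_algebra.
From mathcomp Require Export all_classical all_reals all_analysis.
From mathcomp Require Export finmap freeg.
Set Implicit Arguments.
Unset Strict Implicit.
Unset Printing Implicit Defensive.
Export Order.TTheory GRing.Theory Num.Theory.
Export numFieldNormedType.Exports.

Local Open Scope classical_set_scope.
Local Open Scope ring_scope.

(** ** Singular chains *)

Section SingularChains.
Variable R : realType.

Definition simplex (k : nat) : set 'rV[R]_k.+1 :=
  [set x | (forall i, 0 <= x 0 i) /\ \sum_i x 0 i = 1].
Arguments simplex k : clear implicits.

Definition simplex_interior (k : nat) : set (simplex k) :=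
  [set x | forall i, 0 < (val x : 'rV[R]_k.+1) 0 i].

Definition coface_fun (k : nat) (i : 'I_k.+2) (x : 'rV[R]_k.+1) :
    'rV[R]_k.+2 :=
  \row_j (if unlift i j is Some j' then x 0 j' else 0).

Lemma coface_subproof (k : nat) (i : 'I_k.+2) (x : simplex k) :
  coface_fun i (set_val x) \in simplex k.+1.
Proof.
apply/mem_set; have : simplex k (set_val x) by exact: set_valP.
move: (set_val x) => y [y0 y1].
split => [j|]; first by rewrite mxE; case: unliftP.
rewrite (bigD1_ord i) //= !mxE unlift_none add0r -[RHS]y1.
by apply: eq_bigr => j _; rewrite mxE liftK.
Qed.

Definition coface (k : nat) (i : 'I_k.+2) (x : simplex k) : simplex k.+1 :=
  exist _ (coface_fun i (set_val x)) (coface_subproof i x).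

Lemma coface_fun_continuous (k : nat) (i : 'I_k.+2) :
  continuous (@coface_fun k i).
Proof.
move=> x A /nbhs_ballP[e /= e0 eA].
have := nbhsx_ballx x e e0.
apply: filterS => y [_ xy]; apply: eA; split=> // a j.
by rewrite !mxE; case: unliftP => [j' _|_]; [exact: xy|exact: ballxx].
Qed.

Lemma coface_continuous (k : nat) (i : 'I_k.+2) : continuous (@coface k i).
Proof.
apply/continuous_comp_initial => x.
apply: (@continuous_comp _ _ _ set_val (@coface_fun k i)).
  exact: initial_continuous.
exact: coface_fun_continuous.
Qed.

HB.instance Definition _ (k : nat) (i : 'I_k.+2) :=
  @isContinuous.Build _ _ (@coface k i) (@coface_continuous k i).

Variable T : topologicalType.

Definition sing_simplex (k : nat) := continuousType (simplex k) T.

Definition sing_chain (k : nat) := {freeg (sing_simplex k) / int}.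

Definition sing_face (k : nat) (i : 'I_k.+2) (s : sing_simplex k.+1) :
    sing_simplex k := (s \o @coface k i : continuousType _ _).

Definition sing_bd (k : nat) (c : sing_chain k.+1) : sing_chain k :=
  fglift (fun s => \sum_(i < k.+2) (-1) ^+ i *: (<< sing_face i s >> : sing_chain k)) c.

Definition sing_chain_in (A : set T) (k : nat) : set (sing_chain k) :=
  [set c : sing_chain k |
    forall s : sing_simplex k, s \in dom c -> range s `<=` A].

(* the union of the closed cells of dimension less than k *)
Definition cells_below (n : nat -> nat)
    (char : forall j, 'I_(n j) -> sing_simplex j) (k : nat) : set T :=
  \bigcup_(j in [set j | (j < k)%N]) \bigcup_(e in [set: 'I_(n j)])
    range (char j e).

End SingularChains.
Arguments simplex R k : clear implicits.
Arguments sing_simplex R T k : clear implicits.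
Arguments sing_chain R T k : clear implicits.

(** ** Finite CW complexes and their cellular chains *)

(* The closed k-disc is modelled on the standard k-simplex, so that an oriented
   k-cell is at once a characteristic map and a singular k-simplex.  By
   [cw_incidenceP] the matrix [cw_incidence k] is the connecting map
   H_{k+1}(X^(k+1), X^(k)) -> H_k(X^(k), X^(k-1)) of singular homology written
   in the bases given by the cells.  As these groups are free on the cells,
   [cw_incidence_sq0] follows from the other fields; it is recorded because
   this freeness (excision) is not developed here.  There are finitely many
   cells, so that in a Hausdorff space the weak topology condition is
   automatic. *)
Record finite_cw (R : realType) (d : nat) := FiniteCW {
  cw_space :> topologicalType;
  cw_hausdorff : hausdorff_space cw_space;
  ncell : nat -> nat;
  ncell_dim : (0 < ncell d)%N;
  ncell_gt : forall k, (d < k)%N -> ncell k = 0%N;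
  cw_char : forall k, 'I_(ncell k) -> sing_simplex R cw_space k;
  (* every point lies in exactly one open cell, with a unique preimage there *)
  cw_partition : forall x : cw_space,
    exists! u : {k : nat & ('I_(ncell k) * simplex R k)%type},
      simplex_interior (projT2 u).2 /\
      cw_char (projT2 u).1 (projT2 u).2 = x;
  cw_attach : forall k (e : 'I_(ncell k)) (p : simplex R k),
    ~ simplex_interior p -> cells_below cw_char k (cw_char e p);
  cw_incidence : forall k, 'M[int]_(ncell k, ncell k.+1);
  cw_incidenceP : forall k (e : 'I_(ncell k.+1)),
    exists c : sing_chain R cw_space k.+1, exists c' : sing_chain R cw_space k,
      [/\ sing_chain_in (cells_below cw_char k.+1) c,
          sing_chain_in (cells_below cw_char k) c' &
          sing_bd << cw_char e >> =
            \sum_f cw_incidence k f e *: << cw_char f >> + sing_bd c + c'];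
  cw_incidence_sq0 : forall k, cw_incidence k *m cw_incidence k.+1 = 0
}.

Section CellularHomology.
Variables (R : realType) (d : nat) (X : finite_cw R d).

Definition cell_family := forall k, {set 'I_(ncell X k)}.

(* the union of the open cells in L is closed *)
Definition subcomplex (L : cell_family) : Prop :=
  forall k (e : 'I_(ncell X k)), e \in L k ->
    range (cw_char e) `<=`
    \bigcup_(j in [set: nat]) \bigcup_(f in [set f | f \in L j])
      (cw_char (f : 'I_(ncell X j)) @` @simplex_interior R j).

Definition all_cells : cell_family := fun=> finset.setT.
Definition no_cells : cell_family := fun=> finset.set0.

Section Coefficients.
Variable A : nzRingType.

Definition bd (k : nat) : 'M[A]_(ncell X k, ncell X k.+1) :=
  map_mx intr (cw_incidence X k).

Definition chain_in (L : cell_family) (k : nat) : set 'cV[A]_(ncell X k) :=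
  [set c | forall e, e \notin L k -> c e 0 = 0].

(* H_k(K, L; A) is computed from chains of K modulo chains of L; it is the set
   of cosets of [rel_boundaries] in [rel_cycles].  Absolute homology is the
   case [L = no_cells]. *)
Definition rel_cycles (K L : cell_family) (k : nat) :
    set 'cV[A]_(ncell X k) :=
  match k with
  | 0 => chain_in K (k := 0)
  | k'.+1 => [set c | chain_in K c /\ chain_in L (bd k' *m c)]
  end.

Definition rel_boundaries (K L : cell_family) (k : nat) :
    set 'cV[A]_(ncell X k) :=
  [set c | exists b l, [/\ chain_in K b, chain_in L l & c = bd k *m b + l]].

Definition hclass (K L : cell_family) (k : nat) (z : 'cV[A]_(ncell X k)) :
    set 'cV[A]_(ncell X k) :=
  [set w | rel_boundaries K L (w - z)].

Definition homology (K L : cell_family) (k : nat) :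
    set (set 'cV[A]_(ncell X k)) :=
  [set hclass K L z | z in rel_cycles K L (k := k)].

Definition incl_hom (L : cell_family) (k : nat)
    (x : set 'cV[A]_(ncell X k)) : set 'cV[A]_(ncell X k) :=
  [set w | exists2 z, x z & hclass all_cells no_cells z w].

End Coefficients.

Definition rationalize (k : nat) (x : set 'cV[int]_(ncell X k)) :
    set 'cV[rat]_(ncell X k) :=
  [set w | exists2 z, x z & hclass all_cells no_cells (map_mx intr z) w].

Definition chain_space (L : cell_family) (k : nat) :
    {vspace 'cV[rat]_(ncell X k)} :=
  <<[seq delta_mx e ord0 | e <- enum (L k)]>>%VS.

Definition bd_lin (k : nat) : 'Hom('cV[rat]_(ncell X k.+1), 'cV[rat]_(ncell X k)) :=
  linfun (mulmx (bd rat k)).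

Definition cycle_space (L : cell_family) (k : nat) :
    {vspace 'cV[rat]_(ncell X k)} :=
  match k with
  | 0 => chain_space L 0
  | k'.+1 => (chain_space L k'.+1 :&: lker (bd_lin k'))%VS
  end.

Definition betti (L : cell_family) (k : nat) : nat :=
  \dim (cycle_space L k) - \dim (bd_lin k @: chain_space L k.+1)%VS.

End CellularHomology.
Arguments all_cells {R d} X.
Arguments no_cells {R d} X.
Arguments bd {R d} X A k.
Arguments rel_cycles {R d X} A K L k.
Arguments hclass {R d X A} K L k z.
Arguments homology {R d X} A K L k.
Arguments incl_hom {R d X A} L k x.

Section BoltzmannDistribution.
Variables (R : realType) (n : nat) (X : finite_cw R n.+1).
(* dim X = n + 1, so the weights E live on X_n and W on X_{n+1} *)

(* The Betti condition is empty for n = 0, where it concerns degree -1. *)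
Definition spanning_cotree (L : cell_family X) : Prop :=
  [/\ subcomplex L,
      forall k, (k < n)%N -> L k = finset.setT,
      forall k, (n < k)%N -> L k = finset.set0,
      set_bij (homology rat L (no_cells X) n)
              (homology rat (all_cells X) (no_cells X) n)
              (incl_hom L n) &
      forall m, m.+1 = n -> betti L m = betti (all_cells X) m].

Definition cotree_order (L : cell_family X) : nat :=
  #|` fset_set (homology int (all_cells X) L n)|.

Definition cotree_rep (L : cell_family X) (x : set 'cV[rat]_(ncell X n)) :
    'cV[rat]_(ncell X n) :=
  xget 0 (x `&` rel_cycles rat L (no_cells X) n).

Definition cotree_weight (beta : R) (E : 'rV[R]_(ncell X n))
    (L : cell_family X) : R :=
  (cotree_order L)%:R ^+ 2 * \prod_(b in L n) expR (- (beta * E 0 b)).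

Definition boltzmann (beta : R) (E : 'rV[R]_(ncell X n))
    (x : set 'cV[int]_(ncell X n)) : 'cV[R]_(ncell X n) :=
  (\sum_(L \in [set L | spanning_cotree L]) cotree_weight beta E L)^-1 *:
  \sum_(L \in [set L | spanning_cotree L])
    cotree_weight beta E L *: map_mx ratr (cotree_rep L (rationalize x)).

Definition parameters := ('rV[R]_(ncell X n) * 'rV[R]_(ncell X n.+1))%type.

Definition exp_diag (k : nat) (beta : R) (F : 'rV[R]_k) : 'M[R]_k :=
  diag_mx (map_mx (fun x => expR (beta * x)) F).

(* cells being orthonormal, the adjoint of the boundary is its transpose *)
Definition master_op (beta : R) (p : parameters) : 'M[R]_(ncell X n) :=
  bd X R n *m exp_diag (- beta) p.2 *m (bd X R n)^T *m exp_diag beta p.1.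

Definition smooth (V : normedModType R) (f : R -> V) : Prop :=
  forall m t, derivable (derive1n m f) (t : R) (1 : R).

Definition periodic (V : Type) (f : R -> V) : Prop :=
  forall t, f (t + 1) = f t.

Definition periodic_solution (beta : R) (gamma : R -> parameters)
    (z0 : 'cV[int]_(ncell X n)) (tau : R) (q : R -> 'cV[R]_(ncell X n)) : Prop :=
  [/\ periodic q,
      forall t, hclass (all_cells X) (no_cells X) n (map_mx intr z0) (q t) &
      forall t, is_derive (t : R) (1 : R) q (- tau *: (master_op beta (gamma t) *m q t))].

End BoltzmannDistribution.

(* Main.v *)
Require Import Defs.
From mathcomp Require Import fingroup perm.
From mathcomp Require Import ring lra zify.
Set Implicit Arguments.
Unset Strict Implicit.
Unset Printing Implicit Defensive.
Local Open Scope classical_set_scope.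
Local Open Scope ring_scope.

(** Factor the boundary as [∂ = P Q] over the integers, with [P] injective and
    [Q] split surjective.  A spanning co-tree is the complement of a set [S] of
    n-cells for which the square block [P_S] is invertible; then
    [a_L = |det P_S|] and [psi_L(z) = z - P P_S^-1 z_S], so by Cauchy-Binet and
    Cramer the Boltzmann distribution is the [e^(beta E)]-orthogonal projection
    [z - P G^-1 P^T e^(beta E) z], where [G = P^T e^(beta E) P].

    In the coordinates [q = z + P y] the equation reads
    [y' = - tau A (G y + b)] with [A = Q e^(-beta W) Q^T] and
    [b = P^T e^(beta E) z].  For [g = G y + b], which vanishes exactly at the
    Boltzmann distribution, evaluating the derivative of the periodic function
    [g . A g] at its maximum gives [|g|^2 = O(1 / tau)], and [g = 0] when
    [b = 0].  The latter says that the homogeneous equation has no nonzero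
    periodic solution, whence existence and uniqueness; the former is the
    limit. *)


(** * Cauchy-Binet and Cramer *)

(** Because [Q] has an integral section, the same [P] describes boundaries with every coefficient
    ring: its minors yield torsion orders over the integers, and its real column space carries the
    dynamics. Cauchy-Binet is summed over all maps listing deleted cells; repetitions and singular
    blocks have zero minors and drop out, and adjugates keep the formula for [psi_L] free of
    division until the end.

    The Lyapunov function is [g . A g] rather than [|g|^2] because [G A], a product of two positive
    definite matrices, need not have a positive definite symmetric part. Testing the equation
    against [A g] instead turns the fast term into [- 2 tau (A g) . G (A g)], at most
    [- 2 tau a^3 |g|^2] when [a] bounds both [A] and [G] from below. The constants come from [A],
    [G] and their derivatives alone. The class of [z_0] enters through [b], so it affects the size
    of [g] but not the threshold for [tau]. *)

Section CauchyBinet.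
Variables (K : comNzRingType) (m r : nat).
Implicit Types (A B : 'M[K]_(m, r)) (f : {ffun 'I_r -> 'I_m}).

(** Multilinearity in the rows: distributing the product picks a middle index [f i] for each row.
    Leaving [f] unrestricted is harmless, since a repeated value gives a zero minor of [B]. *)
Lemma det_trmx_mul A B :
  \det (A^T *m B) =
  \sum_(f : {ffun 'I_r -> 'I_m}) (\prod_i A (f i) i) * \det (rowsub f B).
Proof.
rewrite /determinant.
under eq_bigr do under eq_bigr do rewrite mxE.
under eq_bigr do rewrite bigA_distr_bigA /= mulr_sumr.
rewrite exchange_big /=; apply: eq_bigr => f _.
rewrite mulr_sumr; apply: eq_bigr => s _.
rewrite big_split /= mulrCA; congr (_ * (_ * _)).
  by apply: eq_bigr => i _; rewrite mxE.
by apply: eq_bigr => i _; rewrite mxE.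
Qed.

Lemma det_rowsub_perm (f : 'I_r -> 'I_m) (s : 'S_r) B :
  \det (rowsub (f \o s) B) = (-1) ^+ s * \det (rowsub f B).
Proof.
by rewrite rowsub_comp -row_permEsub row_permE det_mulmx det_perm.
Qed.

(* Summing over all maps instead of increasing ones counts every minor r!
   times and avoids ordering the rows. *)
Lemma cauchy_binet A B :
  \sum_(f : {ffun 'I_r -> 'I_m}) \det (rowsub f A) * \det (rowsub f B) =
  r`!%:R * \det (A^T *m B).
Proof.
transitivity (\sum_(s : 'S_r) \det (A^T *m B)); last first.
  by rewrite sumr_const card_Sn mulr_natl.
(* [F s f] is the [s]-term of the Leibniz expansion of the first minor. Precomposing [f] with [s]
   makes the two signs cancel and leaves the summand of [det_trmx_mul], so every [s] contributes one
   copy of the determinant. *)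
pose F (s : 'S_r) f := ((-1) ^+ s * \prod_i A (f i) (s i)) * \det (rowsub f B).
transitivity (\sum_(s : 'S_r) \sum_f F s f).
  rewrite exchange_big /=; apply: eq_bigr => f _.
  rewrite {1}/determinant mulr_suml; apply: eq_bigr => s _.
  by congr (_ * _ * _); apply: eq_bigr => i _; rewrite mxE.
apply: eq_bigr => s _; rewrite det_trmx_mul.
have sK : cancel (fun f => [ffun i => f (s i)]) (fun f => [ffun i => f (s^-1%g i)]).
  by move=> f; apply/ffunP => i; rewrite !ffunE permKV.
have sK' : cancel (fun f => [ffun i => f (s^-1%g i)]) (fun f => [ffun i => f (s i)]).
  by move=> f; apply/ffunP => i; rewrite !ffunE permK.
rewrite (reindex (fun f : {ffun 'I_r -> 'I_m} => [ffun i => f (s i)])) /=; last first.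
  by apply: onW_bij; exists (fun f => [ffun i => f (s^-1%g i)]).
apply: eq_bigr => f _; rewrite /F.
rewrite (_ : rowsub [ffun i => f (s i)] B = rowsub (f \o s) B); last first.
  by apply/matrixP => i j; rewrite !mxE ffunE.
rewrite det_rowsub_perm mulrACA -expr2 sqrr_sign mul1r; congr (_ * _).
rewrite [RHS](reindex_inj (@perm_inj _ s)) /=.
by apply: eq_bigr => i _; rewrite ffunE.
Qed.

End CauchyBinet.

Definition col_subst (K : nzRingType) k r (B : 'M[K]_(k, r)) (i : 'I_r)
    (z : 'cV[K]_k) : 'M[K]_(k, r) :=
  \matrix_(a, b) (if b == i then z a 0 else B a b).

Lemma cramer (K : comNzRingType) r (A : 'M[K]_r) (v : 'cV[K]_r) i :
  (\adj A *m v) i 0 = \det (col_subst A i v).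
Proof.
rewrite (expand_det_col _ i) mxE; apply: eq_bigr => a _.
rewrite !mxE eqxx mulrC; congr (_ * _); rewrite /cofactor; congr (_ * \det _).
by apply/matrixP => x y; rewrite !mxE eq_sym (negPf (neq_lift _ _)).
Qed.

(** By Cramer, coordinate [i] is Cauchy-Binet for [A] and [B] with column [i] of [B] replaced by
    [z]. With adjugates in place of inverses the singular blocks can stay in the sum. *)
Lemma cauchy_binet_adj (K : comNzRingType) m r (A B : 'M[K]_(m, r)) (z : 'cV[K]_m) :
  \sum_(f : {ffun 'I_r -> 'I_m})
    \det (rowsub f A) *: (\adj (rowsub f B) *m rowsub f z) =
  r`!%:R *: (\adj (A^T *m B) *m (A^T *m z)).
Proof.
apply/matrixP => i j; rewrite ord1 [RHS]mxE cramer summxE.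
have -> : col_subst (A^T *m B) i (A^T *m z) = A^T *m col_subst B i z.
  apply/matrixP => a b; rewrite !mxE.
  by case: ifP => bi; apply: eq_bigr => k _; rewrite !mxE bi.
rewrite -cauchy_binet; apply: eq_bigr => f _.
rewrite mxE cramer; congr (_ * \det _).
by apply/matrixP => a b; rewrite !mxE.
Qed.

(** * Integer lattices *)

(** In the Smith normal form [M = L D U], [P] collects the nonzero columns of [L D] and [Q] the
    matching rows of [U]. Unimodularity of [U] splits [Q] over the integers, whereas the elementary
    divisors let [P] have only a rational left inverse. *)
Lemma lattice_factor m k (M : 'M[int]_(m, k)) :
  exists r (P : 'M[int]_(m, r)) (Q : 'M[int]_(r, k)) (Q' : 'M[int]_(k, r))
    (P' : 'M[rat]_(r, m)),
  [/\ M = P *m Q, Q *m Q' = 1%:M & P' *m map_mx intr P = 1%:M].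
Proof.
have [L Lu [U Uu [d _ ->]]] := int_Smith_normal_form M.
set D := \matrix_(i, j) _.
pose S := [set j : 'I_k | [exists i, D i j != 0]]%SET.
pose h (j : 'I_#|S|) : 'I_k := enum_val j.
have hS j : exists i : 'I_m, i = h j :> nat /\ d`_i != 0.
  have := enum_valP j; rewrite inE => /existsP[i]; rewrite mxE => Dij.
  exists i; move: Dij; have [ij|_] := eqVneq (i : nat) (h j);
    last by rewrite mulr0n eqxx.
  by rewrite mulr1n.
(* The row holding the diagonal entry of column [h j]: the same number, in another ordinal type. *)
pose g j : 'I_m := projT1 (cid (hS j)).
have g1 j : g j = h j :> nat by rewrite /g; case: cid => /= ? [].
have g2 j : d`_(g j) != 0 by rewrite /g; case: cid => /= ? [].
have DE : D = colsub h D *m rowsub h 1%:M.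
  apply/matrixP => i j; rewrite [RHS]mxE.
  have [jS|jS] := boolP (j \in S).
    rewrite (bigD1 (enum_rank_in jS j)) //= !mxE /h enum_rankK_in // eqxx mulr1.
    rewrite big1 ?addr0 // => a aj; rewrite !mxE.
    have [e|_] := eqVneq (h a) j; last by rewrite mulr0.
    by case/eqP: aj; apply: enum_val_inj; rewrite enum_rankK_in.
  rewrite big1 => [|a _].
    by apply/eqP; apply: contraNT jS => Dij; rewrite inE; apply/existsP; exists i.
  rewrite !mxE; have [e|_] := eqVneq (h a) j; last by rewrite mulr0.
  by case/negP: jS; rewrite -e enum_valP.
exists #|S|, (L *m colsub h D), (rowsub h U), (invmx U *m colsub h 1%:M),
  (\matrix_(a, i) ((d`_i)%:~R^-1 * (i == g a)%:R) *m map_mx intr (invmx L)).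
split.
- by rewrite -!mulmxA [in LHS]DE -!mulmxA mul_rowsub_mx mul1mx.
- rewrite mulmxA mul_rowsub_mx mulmxV // -mxsub_mul mul1mx.
  by apply/matrixP => i j; rewrite !mxE (inj_eq enum_val_inj).
- rewrite map_mxM mulmxA -(mulmxA (\matrix_(_, _) _)) -map_mxM mulVmx // map_mx1 mulmx1.
  apply/matrixP => a b; rewrite !mxE (bigD1 (g a)) //= !mxE eqxx mulr1.
  rewrite big1 ?addr0 => [|i /negPf ia]; last by rewrite !mxE ia mulr0 mul0r.
  rewrite g1 /h (inj_eq val_inj) (inj_eq enum_val_inj).
  have [_|_] := eqVneq a b; last by rewrite mulr0n mulr0.
  by rewrite mulr1n -g1 mulVf // intr_eq0.
Qed.

Lemma absz_prod (I : finType) (F : I -> int) :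
  absz (\prod_i F i) = (\prod_i absz (F i))%N.
Proof. by elim/big_rec2: _ => // i a b _ <-; rewrite abszM. Qed.

Lemma absz_modz_small (z : nat) (e : int) :
  (z < absz e)%N -> absz (modz z e) = z.
Proof. by move=> ze; rewrite -modz_abs modz_small. Qed.

(** Smith normal form makes the cokernel a product of cyclic groups of orders [|d_i|]. It is
    presented by a surjection whose fibres are the cosets, so that no quotient has to be formed. *)
Lemma lattice_index r (M : 'M[int]_r) : \det M != 0 ->
  exists phi : 'cV[int]_r -> 'I_(absz (\det M)),
    (forall y, exists x, phi x = y) /\
    (forall x y, phi x = phi y <-> exists u, x - y = M *m u).
Proof.
move=> detM; suff [F [phi [cF surj phiP]]] : exists (F : finType) (phi : 'cV[int]_r ->
  F),
    [/\ #|F| = absz (\det M), (forall y, exists x, phi x = y) &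
      forall x y, phi x = phi y <-> exists u, x - y = M *m u].
  exists (fun x => cast_ord cF (enum_rank (phi x))); split=> [y|x y].
    have [x xE] := surj (enum_val (cast_ord (esym cF) y)).
    by exists x; rewrite xE enum_valK cast_ordKV.
  by rewrite -phiP; split=> [/cast_ord_inj/enum_rank_inj|->].
move: detM.
have [L Lu [U Uu [d _ ->]]] := int_Smith_normal_form M.
set D := \matrix_(i, j) _.
have DE : D = diag_mx (\row_(i < r) d`_i).
  by apply/matrixP => i j; rewrite !mxE.
rewrite !det_mulmx => detM.
have dn0 (i : 'I_r) : d`_i != 0.
  move: detM; rewrite !mulf_eq0 !negb_or => /andP[/andP[_]].
  rewrite DE det_diag => /prodf_neq0 /(_ i isT); by rewrite mxE.
have lt (i : 'I_r) (x : int) : (absz (modz x (d`_i)%R) < absz (d`_i)%R)%N.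
  have := ltz_mod x (dn0 i); have := modz_ge0 x (dn0 i).
  by move: (modz x _) => y; lia.
pose F := {dffun forall i : 'I_r, 'I_(absz d`_i)}.
pose phi (x : 'cV[int]_r) : F := [ffun i => Ordinal (lt i ((invmx L *m x) i 0))].
exists F, phi; split.
- rewrite card_dep_ffun foldrE big_map.
  have absU (A : 'M[int]_r) : A \in unitmx -> absz (\det A) = 1%N.
    rewrite unitmxE => /unitrP[y [_ /(congr1 absz)/eqP]].
    by rewrite abszM muln_eq1 => /andP[/eqP].
  rewrite !abszM (absU _ Lu) (absU _ Uu) mul1n muln1 DE det_diag big_enum absz_prod /=.
  by apply: eq_bigr => i _; rewrite card_ord mxE.
- move=> y; exists (L *m \col_i (y i : nat)%:Z); apply/ffunP => i.
  rewrite !ffunE mulmxA mulVmx // mul1mx; apply/val_inj; rewrite /= mxE.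
  exact: absz_modz_small.
- move=> x y; split => [|[u xyu]].
    move=> /ffunP e.
    have dv i : exists u : int, ((invmx L *m (x - y)) i 0) = d`_i * u.
      have := e i; rewrite !ffunE => /(congr1 (fun o => Posz (nat_of_ord o))) /=.
      rewrite !gez0_abs ?modz_ge0 // => /eqP; rewrite eqz_mod_dvd.
      move=> /dvdzP[q qE]; exists q; rewrite mulrC -qE.
      by rewrite mulmxBr [LHS]mxE [X in _ + X]mxE.
    exists (invmx U *m (\col_i projT1 (cid (dv i)))).
    rewrite -!mulmxA (mulmxA U) mulmxV // mul1mx DE.
    apply: (can_inj (mulKVmx Lu)); rewrite mulKmx //.
    apply/matrixP => i j; rewrite ord1 mul_diag_mx [RHS]mxE [X in X * _]mxE [X in _ *
      X]mxE.
    by case: cid.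
  have {}xyu : invmx L *m x = invmx L *m y + D *m (U *m u).
    apply/eqP; rewrite addrC -subr_eq -mulmxBr xyu -!mulmxA mulKmx //.
  apply/ffunP => i; rewrite !ffunE; apply/val_inj; rewrite /= xyu DE.
  by rewrite [X in modz X _]mxE mul_diag_mx [X in _ + X]mxE [X in X * _]mxE addrC mulrC
    modzMDl.
Qed.

(** * Cellular chains and spanning co-trees *)

Section Chains.
Variables (R : realType) (d : nat) (X : finite_cw R d) (A : nzRingType).
Implicit Types (K L : cell_family X) (k : nat).

Lemma chain_inB L k (c c' : 'cV[A]_(ncell X k)) :
  chain_in L c -> chain_in L c' -> chain_in L (c - c').
Proof. by move=> Lc Lc' e eL; rewrite !mxE Lc // Lc' // subr0. Qed.

Lemma chain_in_full L k (c : 'cV[A]_(ncell X k)) :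
  L k = finset.setT -> chain_in L c.
Proof. by move=> Lk e; rewrite Lk inE. Qed.

Lemma chain_in_empty L k (c : 'cV[A]_(ncell X k)) :
  L k = finset.set0 -> chain_in L c -> c = 0.
Proof.
by move=> Lk Lc; apply/matrixP => e j; rewrite ord1 mxE Lc // Lk inE.
Qed.

Lemma chain_in0 L k : chain_in L (0 : 'cV[A]_(ncell X k)).
Proof. by move=> e _; rewrite mxE. Qed.

Lemma bd_bd k : bd X A k *m bd X A k.+1 = 0.
Proof. by rewrite -map_mxM cw_incidence_sq0 map_mx0. Qed.

Lemma rel_cycles_absE L k (z : 'cV[A]_(ncell X k)) :
  rel_cycles A L (no_cells X) k z <->
  chain_in L z /\ rel_cycles A (all_cells X) (no_cells X) k z.
Proof.
have full j (c : 'cV[A]_(ncell X j)) : chain_in (all_cells X) c by exact: chain_in_full.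
case: k z => [|k] z /=; first by split=> [|[]].
by split=> [[]|[? []]].
Qed.

Lemma cyclesP k (z : 'cV[A]_(ncell X k.+1)) :
  rel_cycles A (all_cells X) (no_cells X) k.+1 z <-> bd X A k *m z = 0.
Proof.
split=> [[_ /chain_in_empty->//]|/= ->]; split; first exact: chain_in_full.
exact: chain_in0.
Qed.

Lemma cyclesB k (z z' : 'cV[A]_(ncell X k)) :
  rel_cycles A (all_cells X) (no_cells X) k z ->
  rel_cycles A (all_cells X) (no_cells X) k z' ->
  rel_cycles A (all_cells X) (no_cells X) k (z - z').
Proof.
case: k z z' => [|k] z z'; first by move=> *; exact: chain_in_full.
by move=> /cyclesP bz /cyclesP bz'; apply/cyclesP; rewrite mulmxBr bz bz' subrr.
Qed.

Lemma cycles_bd k (b : 'cV[A]_(ncell X k.+1)) :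
  rel_cycles A (all_cells X) (no_cells X) k (bd X A k *m b).
Proof.
case: k b => [|k] b; first exact: chain_in_full.
by apply/cyclesP; rewrite mulmxA bd_bd mul0mx.
Qed.

Lemma rel_cycles_full L k (z : 'cV[A]_(ncell X k)) :
  (forall j, (j < k)%N -> L j = finset.setT) -> rel_cycles A (all_cells X) L k z.
Proof.
case: k z => [|k] z Lfull; first exact: chain_in_full.
by split; apply: chain_in_full => //; exact: Lfull.
Qed.

Lemma hclass_full k (z w : 'cV[A]_(ncell X k)) :
  hclass (all_cells X) (no_cells X) k z w <-> exists b, w - z = bd X A k *m b.
Proof.
split=> [[b [l [_ /chain_in_empty -> // ->]]]|[b e]].
  by exists b; rewrite addr0.
by exists b, 0; rewrite addr0; split=> //; [exact: chain_in_full|exact: chain_in0].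
Qed.

Lemma hclass_eqP k (z w : 'cV[A]_(ncell X k)) :
  hclass (all_cells X) (no_cells X) k z = hclass (all_cells X) (no_cells X) k w <->
  exists b, w - z = bd X A k *m b.
Proof.
split=> [e|[b e]].
  apply/hclass_full; rewrite e; apply/hclass_full.
  by exists 0; rewrite mulmx0 subrr.
apply/seteqP; split=> v /hclass_full[c vE]; apply/hclass_full.
  by exists (c - b); rewrite mulmxBr -e -vE opprB addrA subrK.
by exists (c + b); rewrite mulmxDr -e -vE addrA subrK.
Qed.

Lemma hclass_no_boundary L k (z : 'cV[A]_(ncell X k)) :
  L k.+1 = finset.set0 -> hclass L (no_cells X) k z = [set z].
Proof.
move=> Lk; apply/seteqP; split=> w.
  move=> [b [l [/chain_in_empty -> // /chain_in_empty -> //]]].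
  by rewrite mulmx0 addr0 => /eqP; rewrite subr_eq0 => /eqP.
move=> ->; exists 0, 0; split; [exact: chain_in0|exact: chain_in0|].
by rewrite subrr mulmx0 addr0.
Qed.

Lemma incl_hom1 L k (z : 'cV[A]_(ncell X k)) :
  incl_hom L k [set z] = hclass (all_cells X) (no_cells X) k z.
Proof. by apply/seteqP; split=> [w [_ ->]|w zw] //; exists z. Qed.

End Chains.

Section CoefficientChange.
Variables (R : realType) (d : nat) (X : finite_cw R d) (A : nzRingType).

Lemma map_bd k (b : 'cV[int]_(ncell X k.+1)) :
  map_mx intr (bd X int k *m b) = bd X A k *m map_mx intr b.
Proof.
by rewrite map_mxM; congr (_ *m _); apply/matrixP => i j; rewrite !mxE intz.
Qed.

Lemma map_cycles k (z : 'cV[int]_(ncell X k)) :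
  rel_cycles int (all_cells X) (no_cells X) k z ->
  rel_cycles A (all_cells X) (no_cells X) k (map_mx intr z).
Proof.
case: k z => [|k] z; first by move=> _; exact: chain_in_full.
case=> _ bz; apply/cyclesP; rewrite -map_bd.
by rewrite (chain_in_empty _ bz) // map_mx0.
Qed.

End CoefficientChange.

Section Betti.
Variables (R : realType) (d : nat) (X : finite_cw R d).
Implicit Types (L : cell_family X) (k : nat).

Lemma mem_chain_space L k (c : 'cV[rat]_(ncell X k)) :
  c \in chain_space L k <-> chain_in L c.
Proof.
split=> [/coord_span -> e eL|Lc].
  rewrite summxE big1 // => i _; rewrite mxE (nth_map e) ?size_tuple // mxE eqxx andbT.
  have [ei|] := eqVneq e (nth e (enum_tuple (L k)) i); last by rewrite mulr0.
  by case/negP: eL; rewrite ei -mem_enum mem_nth // -cardE.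
rewrite (matrix_sum_delta c); apply: memv_suml => e _.
rewrite big_ord1; have [eL|eL] := boolP (e \in L k);
  last by rewrite Lc // scale0r mem0v.
apply: memvZ; apply: memv_span; apply/mapP; exists e => //; by rewrite mem_enum.
Qed.

Lemma bd_linE k (c : 'cV[rat]_(ncell X k.+1)) : bd_lin X k c = bd X rat k *m c.
Proof. by rewrite lfunE. Qed.

Lemma sub_bd_cycles L k :
  (bd_lin X k @: chain_space L k.+1 <= cycle_space (all_cells X) k)%VS.
Proof.
have full j (c : 'cV[rat]_(ncell X j)) : c \in chain_space (all_cells X) j.
  by apply/mem_chain_space; exact: chain_in_full.
apply/subvP => _ /memv_imgP[c _ ->]; case: k c => [|k] c /=; first exact: full.
by rewrite memv_cap full /= memv_ker !bd_linE mulmxA bd_bd mul0mx.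
Qed.

(** Since [L] has all [m]-cells, both Betti numbers subtract from the same space of cycles. They
    agree exactly when the boundary spaces, one inside the other, have equal dimension and hence
    coincide. *)
Lemma betti_eqP L m : L m = finset.setT ->
  betti L m = betti (all_cells X) m <->
  forall z : 'cV[rat]_(ncell X m.+1),
    exists2 t, chain_in L t & bd X rat m *m (z - t) = 0.
Proof.
move=> Lm.
have cycE : cycle_space L m = cycle_space (all_cells X) m.
  have csE : chain_space L m = chain_space (all_cells X) m by rewrite /chain_space Lm.
  by case: m Lm csE => [|m] Lm csE; rewrite /= csE.
have csub : (bd_lin X m @: chain_space L m.+1 <=
    bd_lin X m @: chain_space (all_cells X) m.+1)%VS.
  by apply: limgS; apply/subvP => c _; apply/mem_chain_space/chain_in_full.
rewrite /betti cycE; split=> [e z|H].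
  have {}e : (bd_lin X m @: chain_space L m.+1 =
    bd_lin X m @: chain_space (all_cells X) m.+1)%VS.
    apply/eqP; rewrite eqEdim csub /=.
    (* Betti numbers are truncated differences; cancelling is legitimate because boundaries lie
       among cycles. *)
    have cancel (a b c : nat) : (c - b = c - a -> b <= a -> a <= c -> a <= b)%N by lia.
    exact: cancel e (dimvS csub) (dimvS (sub_bd_cycles _ _)).
  have : bd_lin X m z \in (bd_lin X m @: chain_space (all_cells X) m.+1)%VS.
    by apply: memv_img; apply/mem_chain_space/chain_in_full.
  rewrite -e => /memv_imgP[t /mem_chain_space Lt]; rewrite !bd_linE => zt.
  by exists t => //; rewrite mulmxBr zt subrr.
congr (_ - \dim _)%N; apply/eqP; rewrite eqEsubv csub /=.
apply/subvP => _ /memv_imgP[z _ ->]; have [t Lt] := H z.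
rewrite mulmxBr => /eqP; rewrite subr_eq0 => /eqP e.
by rewrite bd_linE e -bd_linE memv_img //; apply/mem_chain_space.
Qed.

(** This form also covers [k = 0]: there the Betti condition is vacuous and every 0-chain is a
    cycle, so [t = 0] will do. *)
Lemma betti_cyclesP L k : (forall j, (j < k)%N -> L j = finset.setT) ->
  (forall m, m.+1 = k -> betti L m = betti (all_cells X) m) <->
  (forall z : 'cV[rat]_(ncell X k), exists2 t, chain_in L t &
     rel_cycles rat (all_cells X) (no_cells X) k (z - t)).
Proof.
case: k => [|k] lo.
  by split=> // _ z; exists 0; [exact: chain_in0|exact: chain_in_full].
split=> [H z|H _ [->]].
  have /betti_eqP := H k erefl; rewrite lo // => /(_ erefl z)[t Lt e].
  by exists t => //; apply/cyclesP.
apply/betti_eqP; first exact: lo.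
by move=> z; have [t Lt /cyclesP] := H z; exists t.
Qed.

End Betti.

Section Cotrees.
Variables (R : realType) (n : nat) (X : finite_cw R n.+1).
Implicit Types (T : {set 'I_(ncell X n)}) (L : cell_family X).

(** Comparing tagged cells avoids transporting [e] along an equation [k = n]. *)
Definition cotree_of T : cell_family X := fun k =>
  [set e : 'I_(ncell X k) | (k < n)%N ||
     [exists f in T, Tagged (fun k => 'I_(ncell X k)) e == Tagged (fun k => 'I_(ncell X
       k)) f]]%SET.

Lemma cotree_of_dim T : cotree_of T n = T.
Proof.
apply/setP => e; rewrite inE ltnn /=;
  apply/idP/idP => [/fintype.existsP[f /andP[fT]]|eT].
  by rewrite eq_Tagged /= => /eqP ->.
by apply/fintype.existsP; exists e; rewrite eT eqxx.
Qed.

Lemma cotree_of_lt T k : (k < n)%N -> cotree_of T k = finset.setT.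
Proof. by move=> kn; apply/setP => e; rewrite !inE kn. Qed.

Lemma cotree_of_gt T k : (n < k)%N -> cotree_of T k = finset.set0.
Proof.
move=> nk; apply/setP => e; rewrite !inE ltnNge ltnW //=.
apply/negbTE/negP => /fintype.existsP[f /andP[_ /eqP/(congr1 (@tag _ _)) /= kn]].
by rewrite kn ltnn in nk.
Qed.

Lemma cotree_ofK L : (forall k, (k < n)%N -> L k = finset.setT) ->
  (forall k, (n < k)%N -> L k = finset.set0) -> cotree_of (L n) = L.
Proof.
move=> lo hi; apply: functional_extensionality_dep => k.
have [kn|kn|->] := ltngtP k n; last exact: cotree_of_dim.
  by rewrite cotree_of_lt // lo.
by rewrite cotree_of_gt // hi.
Qed.

(** A boundary point of a cell of dimension at most [n] lies in a closed cell of smaller dimension,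
    which belongs to [L]; induction on the dimension places it in an open cell of [L]. *)
Lemma subcomplex_skeleton L : (forall k, (k < n)%N -> L k = finset.setT) ->
  (forall k, (n < k)%N -> L k = finset.set0) -> subcomplex L.
Proof.
move=> lo hi.
have H k : forall e : 'I_(ncell X k), e \in L k ->
    range (cw_char e) `<=` \bigcup_(j in [set: nat])
      \bigcup_(f in [set f | f \in L j]) (cw_char (f : 'I_(ncell X j)) @`
        @simplex_interior R j).
  elim/ltn_ind: k => k IH e eL _ [p _ <-].
  have [pint|pint] := pselect (simplex_interior p).
    by exists k => //; exists e => //; exists p.
  have [j jk [f _ fx]] := cw_attach e pint.
  apply: (IH j jk f) fx.
  have kn : (k <= n)%N by rewrite leqNgt; apply/negP => /hi kn; rewrite kn inE in eL.
  by rewrite lo ?inE // (leq_trans jk).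
by move=> k e; exact: H.
Qed.

Definition complementary T :=
  (forall z : 'cV[rat]_(ncell X n), exists y,
     chain_in (cotree_of T) (z - bd X rat n *m y)) /\
  (forall y, chain_in (cotree_of T) (bd X rat n *m y) -> bd X rat n *m y = 0).


(** Homology of [L] in degree [n] is just its cycles. Injectivity says that no nonzero boundary is
    carried by [T]. Surjectivity moves cycles onto [T] modulo boundaries, and the Betti condition
    moves chains onto [T] modulo cycles; together they say that boundaries and chains on [T]
    span. *)
Lemma spanning_cotreeP T : spanning_cotree (cotree_of T) <-> complementary T.
Proof.
have lo := @cotree_of_lt T; have hi := @cotree_of_gt T.
rewrite /complementary; move: (cotree_of T) lo hi => L lo hi.
have L1 (z : 'cV[rat]_(ncell X n)) : hclass L (no_cells X) n z = [set z].
  by apply: hclass_no_boundary; exact: hi.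
split.
  case=> _ _ _ [_ inj surj] /(betti_cyclesP lo) H; split=> [z|y Ly].
    have [t Lt zt] := H z.
    (* The cycle [z - t] is homologous to some [z'] on [L], so [z] differs from the chain [t + z']
       on [T] by a boundary. *)
    have [_ [z' Lz' <-]] := surj _ (imageP _ zt).
    have /rel_cycles_absE[Lz'' _] := Lz'.
    rewrite L1 incl_hom1 => /hclass_eqP[b e]; exists b; rewrite -e.
    rewrite opprB addrCA subKr; move=> f fL; rewrite mxE Lz'' // Lt // addr0 //.
  have hz : homology rat L (no_cells X) n [set bd X rat n *m y].
    by exists (bd X rat n *m y); [apply/rel_cycles_absE; split=> //;
      exact: cycles_bd|rewrite L1].
  have h0 : homology rat L (no_cells X) n [set 0].
    by exists 0; [apply/rel_cycles_absE; split;
      [exact: chain_in0|rewrite -[0](mulmx0 _ (bd X rat n));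
        exact: cycles_bd]|rewrite L1].
  have : [set bd X rat n *m y] = [set 0].
    apply: inj; [exact: mem_set|exact: mem_set|]; rewrite !incl_hom1; apply/hclass_eqP.
    by exists (- y); rewrite mulmxN sub0r.
  by move=> e; have : [set 0 : 'cV[rat]_(ncell X n)] (bd X rat n *m y) by rewrite -e.
case=> ex uniq; split=> //; first exact: subcomplex_skeleton.
- split.
  + move=> _ [z /rel_cycles_absE[Lz Zz] <-]; rewrite L1 incl_hom1; exists z => //.
  + move=> c1 c2 /set_mem[z1 /rel_cycles_absE[Lz1 Zz1] <-] /set_mem[z2
    /rel_cycles_absE[Lz2 Zz2] <-].
    rewrite !L1 !incl_hom1 => /hclass_eqP[b e].
    have : bd X rat n *m b = 0 by apply: uniq; rewrite -e; exact: chain_inB.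
    by rewrite -e => /eqP; rewrite subr_eq0 => /eqP ->.
  + move=> _ [z Zz <-]; have [y Ly] := ex z.
    exists [set z - bd X rat n *m y].
      exists (z - bd X rat n *m y); last by rewrite L1.
      by apply/rel_cycles_absE; split=> //; apply: cyclesB => //; exact: cycles_bd.
    by rewrite incl_hom1; apply/hclass_eqP; exists y; rewrite subKr.
- apply/(betti_cyclesP lo) => z; have [y Ly] := ex z.
  by exists (z - bd X rat n *m y) => //; rewrite subKr; exact: cycles_bd.
Qed.

End Cotrees.

(** * Co-trees as nonzero maximal minors of the integral boundary *)

Section CotreeMinors.
Variables (R : realType) (n : nat) (X : finite_cw R n.+1).
Variables (r : nat) (P : 'M[int]_(ncell X n, r)) (Q : 'M[int]_(r, ncell X n.+1)).
Variables (Q' : 'M[int]_(ncell X n.+1, r)) (P' : 'M[rat]_(r, ncell X n)).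
Hypothesis incE : cw_incidence X n = P *m Q.
Hypothesis QQ' : Q *m Q' = 1%:M.
Hypothesis P'P : P' *m map_mx intr P = 1%:M.
Implicit Types (T : {set 'I_(ncell X n)}) (L : cell_family X).
Implicit Types (f : {ffun 'I_r -> 'I_(ncell X n)}).

Lemma bd_factor (A : nzRingType) : bd X A n = map_mx intr P *m map_mx intr Q.
Proof. by rewrite /bd incE map_mxM. Qed.

(** The integral section [Q'] survives every change of coefficients, so integral, rational and real
    boundaries are column spaces of the same [P]. *)
Lemma boundaryP (A : nzRingType) (w : 'cV[A]_(ncell X n)) :
  (exists b, w = bd X A n *m b) <-> (exists y, w = map_mx intr P *m y).
Proof.
rewrite bd_factor; split=> [[b ->]|[y ->]].
  by exists (map_mx intr Q *m b); rewrite mulmxA.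
exists (map_mx intr Q' *m y).
by rewrite mulmxA -(mulmxA (map_mx _ P)) -map_mxM QQ' map_mx1 mulmx1.
Qed.

(** Deleted cells are listed by a map, as in the Cauchy-Binet sum; this is the set of cells kept. *)
Definition coim f : {set 'I_(ncell X n)} := (~: (f @: [set: 'I_r]))%SET.

Lemma chain_in_coim (A : nzRingType) f (c : 'cV[A]_(ncell X n)) :
  chain_in (cotree_of (coim f)) c <-> rowsub f c = 0.
Proof.
split=> [cf|cf e].
  apply/matrixP => i j; rewrite ord1 !mxE cf // cotree_of_dim !inE negbK.
  exact: imset_f.
rewrite cotree_of_dim !inE negbK => /imsetP[i _ ->].
by have /matrixP/(_ i 0) := cf; rewrite !mxE.
Qed.

Lemma complementaryP T : complementary T <->
  (forall z : 'cV[rat]_(ncell X n), exists y,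
     chain_in (cotree_of T) (z - map_mx intr P *m y)) /\
  (forall y : 'cV[rat]_r, chain_in (cotree_of T) (map_mx intr P *m y) -> y = 0).
Proof.
split=> -[ex uniq]; split=> [z|y Ty].
- have [b Tb] := ex z.
  by have /boundaryP[y e] : exists b', bd X rat n *m b = bd X rat n *m b';
    [exists b|exists y; rewrite -e].
- have [b e] : exists b, map_mx intr P *m y = bd X rat n *m b by apply/boundaryP;
  exists y.
  by rewrite -[y]mul1mx -P'P -mulmxA e uniq -?e // mulmx0.
- have [y Ty] := ex z.
  have [b e] : exists b, map_mx intr P *m y = bd X rat n *m b by apply/boundaryP;
    exists y.
  by exists b; rewrite -e.
- have /boundaryP[y' e] : exists b, bd X rat n *m y = bd X rat n *m b by exists y.
  by move: Ty; rewrite e => /uniq ->; rewrite mulmx0.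
Qed.

Lemma det_rowsub_inj (A : comNzRingType) (B : 'M[A]_(ncell X n, r)) f :
  \det (rowsub f B) != 0 -> injective f.
Proof.
move=> df i j fij; apply/eqP/negPn/negP => ij; case/eqP: df.
by apply: (determinant_alternate ij) => k; rewrite !mxE fij.
Qed.

Lemma map_rowsub_intr (A : nzRingType) f :
  rowsub f (map_mx intr P : 'M[A]_(_, _)) = map_mx intr (rowsub f P).
Proof. by apply/matrixP => i j; rewrite !mxE. Qed.

Lemma unit_rowsub (K : numFieldType) f :
  (rowsub f (map_mx intr P : 'M[K]_(_, _)) \in unitmx) = (\det (rowsub f P) != 0).
Proof. by rewrite map_rowsub_intr unitmxE det_map_mx unitfE intr_eq0. Qed.

(** Restriction to the deleted cells has the chains on [coim f] as kernel, so the boundaries are a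
    complement exactly when it maps them isomorphically. In the coordinates given by [P] this map is
    the block [rowsub f P]. *)
Lemma complementary_det f : injective f ->
  complementary (coim f) <-> \det (rowsub f P) != 0.
Proof.
move=> finj; rewrite complementaryP -(unit_rowsub rat); split=> [[_ inj]|fu].
  rewrite unitmxE unitfE -det_tr; apply/det0P => -[v vn0 vf].
  case/eqP: vn0; apply: trmx_inj; rewrite trmx0; apply: inj.
  apply/chain_in_coim; rewrite -mul_rowsub_mx; apply: trmx_inj.
  by rewrite trmx_mul trmxK vf trmx0.
split=> [z|y /chain_in_coim].
  exists (invmx (rowsub f (map_mx intr P)) *m rowsub f z).
  apply/chain_in_coim/eqP; rewrite linearB /= -mul_rowsub_mx mulKVmx //.
  by rewrite subrr.
rewrite -mul_rowsub_mx => /(congr1 (mulmx (invmx (rowsub f (map_mx intr P))))).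
by rewrite mulKmx // mulmx0.
Qed.

(** The restriction to the cells outside [T] is not yet known to be square: surjectivity bounds its
    number of rows by [r], injectivity gives the reverse inequality. *)
Lemma complementary_card T : complementary T -> #|(~: T)%SET| = r.
Proof.
move=> /complementaryP[surj inj].
pose h (i : 'I_#|(~: T)%SET|) : 'I_(ncell X n) := enum_val i.
pose M := rowsub h (map_mx intr P) : 'M[rat]_(_, _).
have hT (c : 'cV[rat]_(ncell X n)) : chain_in (cotree_of T) c <-> rowsub h c = 0.
  split=> [Tc|hc e].
    apply/matrixP => i j; rewrite ord1 !mxE Tc // cotree_of_dim -finset.in_setC.
    exact: enum_valP.
  rewrite cotree_of_dim -finset.in_setC => eT.
  have /matrixP/(_ (enum_rank_in eT e) 0) := hc.
  by rewrite !mxE /h enum_rankK_in.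
apply/eqP; rewrite eqn_leq; apply/andP; split.
  suff : row_full M^T by move/eqP <-; exact: rank_leq_row.
  rewrite -sub1mx; apply/row_subP => i; rewrite rowE mulmx1.
  have [y /hT/eqP] := surj (delta_mx (h i) 0).
  rewrite linearB /= subr_eq0 => /eqP e; apply/submxP; exists y^T.
  rewrite -trmx_mul mul_rowsub_mx -e; apply/matrixP => a b.
  by rewrite !mxE (inj_eq enum_val_inj) andbC.
suff : row_free M^T by move/eqP <-; exact: rank_leq_col.
rewrite -kermx_eq0; apply/eqP/row_matrixP => i; rewrite row0.
apply: trmx_inj; rewrite trmx0; apply: inj; apply/hT.
rewrite -mul_rowsub_mx; apply: trmx_inj.
by rewrite trmx_mul trmxK -row_mul mulmx_ker row0 trmx0.
Qed.

(** A nonzero minor forces [f] to be injective, and each complementary [T] arises from the [r!]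
    bijections onto its complement. This factor matches the one in [cauchy_binet]. *)
Lemma sum_complementary (V : nmodType) (F : {set 'I_(ncell X n)} -> V) :
  \sum_(f : {ffun 'I_r -> 'I_(ncell X n)} | \det (rowsub f P) != 0) F (coim f) =
  (\sum_(T | `[< complementary T >]) F T) *+ r`!.
Proof.
rewrite (partition_big coim (fun T => `[< complementary T >])) /=; last first.
  move=> f df; apply/asboolP/complementary_det => //; exact: det_rowsub_inj df.
rewrite -sumrMnl; apply: eq_bigr => T /asboolP cT.
under eq_bigr => f /andP[_ /eqP ->] do over.
rewrite sumr_const; congr (_ *+ _).
have cardT := complementary_card cT.
transitivity #|[set f : {ffun 'I_r -> 'I_(ncell X n)} in ffun_on (~: T)%SET |
  injectiveb f]|.
  apply: eq_card => f; rewrite !inE; apply/andP/andP => -[].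
    move=> df /eqP fT; split.
      by apply/ffun_onP => i; rewrite -fT /coim !inE negbK; exact: imset_f.
    by apply/injectiveP; exact: det_rowsub_inj df.
  move=> /ffun_onP fT /injectiveP finj.
  have e : coim f = T.
    rewrite /coim -[RHS]finset.setCK; congr (~: _)%SET; apply/eqP.
    rewrite eqEcard cardT card_imset // cardsT card_ord leqnn andbT.
    by apply/fintype.subsetP => _ /imsetP[i _ ->]; exact: fT.
  split; last by rewrite e.
  by apply/complementary_det => //; rewrite e.
by rewrite card_inj_ffuns_on card_ord cardT ffactnn.
Qed.

(** A co-tree is determined by its [n]-cells, which turns the sum over cell families into one over a
    finite type. *)
Lemma sum_spanning_cotree (V : nmodType) (F : cell_family X -> V) :
  \sum_(L \in [set L | spanning_cotree L]) F L =
  \sum_(T | `[< complementary T >]) F (cotree_of T).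
Proof.
rewrite (reindex_fsbig (@cotree_of R n X) [set T | complementary T]); last first.
  split.
  - by move=> T /= cT; apply/spanning_cotreeP.
  - by move=> T T' _ _ e; rewrite -(cotree_of_dim T) e cotree_of_dim.
  - move=> L; case=> sL lo hi Lbij Lbet.
    have LE := cotree_ofK lo hi.
    by exists (L n) => //; apply/spanning_cotreeP; rewrite LE.
rewrite fsbig_mkcond (fsbig_fwiden (index_enum {set 'I_(ncell X n)})) //.
- rewrite [RHS]big_mkcond; apply: eq_bigr => T _; rewrite /patch /=.
  by case: asboolP => cT; [rewrite mem_set|rewrite memNset].
- by move=> T _; rewrite /= mem_index_enum.
- exact: index_enum_uniq.
- by move=> T [_]; case.
Qed.

(** Since [L] contains all lower cells, every [n]-chain is a relative cycle. Dividing by chains on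
    [L] leaves the coordinates on deleted cells, and dividing by boundaries leaves the cokernel of
    the square block, counted by [lattice_index]. *)
Lemma cotree_orderE f : \det (rowsub f P) != 0 ->
  cotree_order (cotree_of (coim f)) = absz (\det (rowsub f P)).
Proof.
move=> df; have finj := det_rowsub_inj df.
have [phi [surj phiP]] := lattice_index df.
(* Extension by zero, a section of [rowsub f] because [f] is injective. *)
pose ext (v : 'cV[int]_r) : 'cV[int]_(ncell X n) :=
  \col_e (if [pick i | f i == e] is Some i then v i 0 else 0).
have extK v : rowsub f (ext v) = v.
  apply/matrixP => i j; rewrite ord1 !mxE; case: pickP => [k /eqP/finj -> //|].
  by move=> /(_ i); rewrite eqxx.
pose HK := @hclass R n.+1 X int (all_cells X) (cotree_of (coim f)) n.
have hclassP z w : HK z w <-> phi (rowsub f z) = phi (rowsub f w).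
  rewrite phiP /HK /hclass /= /rel_boundaries /=; split.
    move=> [b [l [_ Ll e]]].
    have /boundaryP[y yE] : exists b', bd X int n *m b = bd X int n *m b' by exists b.
    exists (- y); rewrite mulmxN mul_rowsub_mx -linearB /=.
    have -> : z - w = - (map_mx intr P *m y) - l by rewrite -yE -opprD -e opprB.
    move/chain_in_coim: Ll => Ll; rewrite linearB /= Ll subr0 linearN /=.
    by congr (- mxsub _ _ (_ *m _)); apply/matrixP => i j; rewrite mxE intz.
  move=> [u e]; have [b bE] : exists b, map_mx intr P *m - u = bd X int n *m b.
    by apply/boundaryP; exists (- u).
  exists b, (w - z - bd X int n *m b); split; first exact: chain_in_full.
    apply/chain_in_coim; rewrite -bE mulmxN opprK linearD /= -opprB linearN /= linearB
      /= e.
    by rewrite mul_rowsub_mx addrC; apply/eqP; rewrite subr_eq0; apply/eqP;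
      congr (mxsub _ _ (_ *m _)); apply/matrixP => i j; rewrite mxE intz.
  by rewrite [RHS]addrC subrK.
have HKE z w : HK z = HK w <-> phi (rowsub f z) = phi (rowsub f w).
  split=> [e|e]; first by apply/hclassP; rewrite e; apply/hclassP.
  by apply/seteqP; split=> v /hclassP ev; apply/hclassP; rewrite -ev ?e.
apply: card_fset_set.
pose g y := HK (ext (projT1 (cid (surj y)))).
have gphi y : phi (rowsub f (ext (projT1 (cid (surj y))))) = y.
  by rewrite extK; case: cid.
have -> : homology int (all_cells X) (cotree_of (coim f)) n = [set g y | y in [set:
  'I_(absz (\det (rowsub f P)))]].
  apply/seteqP; split=> [_ [z _ <-]|_ [y _ <-]].
    by exists (phi (rowsub f z)) => //; apply/HKE; rewrite gphi.
  by exists (ext (projT1 (cid (surj y)))) => //; apply: rel_cycles_full => k;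
    exact: cotree_of_lt.
apply: (@card_eq_trans _ _ _ _ [set: 'I_(absz (\det (rowsub f P)))]).
  by apply: inj_card_eq => y y' _ _ /HKE; rewrite !gphi.
by rewrite card_eq_sym; exact: card_II.
Qed.

Definition cotree_proj (K : fieldType) f : 'M[K]_(ncell X n) :=
  1%:M - map_mx intr P *m invmx (rowsub f (map_mx intr P)) *m rowsub f 1%:M.

Lemma cotree_projE (K : fieldType) f (z : 'cV[K]_(ncell X n)) :
  cotree_proj K f *m z =
  z - map_mx intr P *m (invmx (rowsub f (map_mx intr P)) *m rowsub f z).
Proof. by rewrite /cotree_proj mulmxBl mul1mx -!mulmxA -rowsubE. Qed.

Lemma cotree_repE f (z0 : 'cV[int]_(ncell X n)) :
  \det (rowsub f P) != 0 ->
  rel_cycles int (all_cells X) (no_cells X) n z0 ->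
  cotree_rep (cotree_of (coim f)) (rationalize (hclass (all_cells X) (no_cells X) n
    z0)) =
  cotree_proj rat f *m map_mx intr z0.
Proof.
move=> df Zz0; have fu := df; rewrite -(unit_rowsub rat) in fu.
pose z : 'cV[rat]_(ncell X n) := map_mx intr z0.
have Zz : rel_cycles rat (all_cells X) (no_cells X) n z by exact: map_cycles.
have ratP w : rationalize (hclass (all_cells X) (no_cells X) n z0) w <->
    exists y, w = z + map_mx intr P *m y.
  split=> [[z1 /hclass_full[b e] /hclass_full[b' e']]|[y ->]].
    have /boundaryP[y yE] : exists b0, w - z = bd X rat n *m b0.
      exists (b' + map_mx intr b); rewrite mulmxDr -e' -map_bd -e map_mxB.
      by rewrite addrA subrK.
    by exists y; rewrite -yE addrC subrK.
  exists z0; first by apply/hclass_full; exists 0; rewrite mulmx0 subrr.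
  by apply/hclass_full; rewrite addrC addKr; apply/boundaryP; exists y.
rewrite cotree_projE -/z; apply: xget_unique.
  split; first by apply/ratP; eexists; rewrite -mulmxN; reflexivity.
  apply/rel_cycles_absE; split.
    by apply/chain_in_coim; rewrite linearB /= -mul_rowsub_mx mulKVmx // subrr.
  apply: cyclesB => //.
  have [b ->] : exists b, map_mx intr P *m (invmx (rowsub f (map_mx intr P)) *m rowsub
    f z) = bd X rat n *m b.
    by apply/boundaryP; eexists; reflexivity.
  exact: cycles_bd.
(* Uniqueness: vanishing of [z + P y] on the deleted cells means [P_S y = - z_S], which determines
   [y]. *)
move=> w [/ratP[y ->] /rel_cycles_absE[/chain_in_coim wf _]].
move: wf; rewrite linearD /= -mul_rowsub_mx => /eqP; rewrite addrC addr_eq0 => /eqP e.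
by rewrite -[y in LHS](mulKmx fu) e !mulmxN.
Qed.

End CotreeMinors.

(** * The Boltzmann distribution as a weighted projection *)

Lemma gram_form (K : comNzRingType) m r (P : 'M[K]_(m, r)) (e : 'rV[K]_m) (x :
  'cV[K]_r) :
  (x^T *m (P^T *m diag_mx e *m P *m x)) 0 0 = \sum_j e 0 j * (P *m x) j 0 ^+ 2.
Proof.
rewrite -!mulmxA mulmxA -trmx_mul mxE; apply: eq_bigr => j _.
by rewrite mul_diag_mx !mxE expr2 mulrCA.
Qed.

Lemma gram_unit (K : realFieldType) m r (P : 'M[K]_(m, r)) (P' : 'M[K]_(r, m))
    (e : 'rV[K]_m) : P' *m P = 1%:M -> (forall j, 0 < e 0 j) ->
  P^T *m diag_mx e *m P \in unitmx.
Proof.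
move=> P'P e0; rewrite unitmxE unitfE -det_tr; apply/det0P => -[v vn0 vf].
case/eqP: vn0; apply: trmx_inj; rewrite trmx0 -[v^T]mul1mx -P'P -mulmxA.
suff -> : P *m v^T = 0 by rewrite mulmx0.
have : ((v^T)^T *m (P^T *m diag_mx e *m P *m v^T)) 0 0 = 0.
  by rewrite -[X in _ *m X]trmxK trmx_mul !trmxK vf trmx0 mulmx0 mxE.
rewrite gram_form => /eqP; rewrite psumr_eq0 => [|j _]; last first.
  by rewrite mulr_ge0 ?sqr_ge0 // ltW.
move=> /allP s0; apply/matrixP => j k; rewrite ord1 [RHS]mxE.
have := s0 j (mem_index_enum _); rewrite mulf_eq0 (gt_eqF (e0 j)) /=.
by rewrite expf_eq0 /= => /eqP.
Qed.

Section Boltzmann.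
Variables (R : realType) (n : nat) (X : finite_cw R n.+1).
Variables (r : nat) (P : 'M[int]_(ncell X n, r)) (Q : 'M[int]_(r, ncell X n.+1)).
Variables (Q' : 'M[int]_(ncell X n.+1, r)) (P' : 'M[rat]_(r, ncell X n)).
Hypothesis incE : cw_incidence X n = P *m Q.
Hypothesis QQ' : Q *m Q' = 1%:M.
Hypothesis P'P : P' *m map_mx intr P = 1%:M.
Variables (beta : R) (E : 'rV[R]_(ncell X n)) (z0 : 'cV[int]_(ncell X n)).
Hypothesis Zz0 : rel_cycles int (all_cells X) (no_cells X) n z0.
Implicit Types (f : {ffun 'I_r -> 'I_(ncell X n)}).

Local Notation PR := (map_mx intr P : 'M[R]_(ncell X n, r)).
Local Notation z := (map_mx intr z0 : 'cV[R]_(ncell X n)).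
Local Notation D := (exp_diag beta E).
Local Notation G := (PR^T *m D *m PR).

Lemma left_inverse : map_mx ratr P' *m PR = 1%:M.
Proof.
rewrite -(map_mx1 ratr) -P'P map_mxM; congr (_ *m _).
by apply/matrixP => i j; rewrite !mxE; exact/esym/ratr_int.
Qed.

Lemma weighted_gram_unit : G \in unitmx.
Proof. by apply: (gram_unit left_inverse) => j; rewrite mxE expR_gt0. Qed.

Let c := \prod_b expR (- (beta * E 0 b)).

Lemma det_rowsub_weighted f :
  \det (rowsub f (D *m PR)) = (\prod_i expR (beta * E 0 (f i))) * \det (rowsub f PR).
Proof.
have -> : rowsub f (D *m PR) = diag_mx (\row_i expR (beta * E 0 (f i))) *m rowsub f PR.
  by apply/matrixP => i j; rewrite mxE !mul_diag_mx !mxE.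
by rewrite det_mulmx det_diag; congr (_ * _); apply: eq_bigr => i _; rewrite mxE.
Qed.

(** The weight is a product over kept cells while the minors see the deleted ones. Pulling out the
    product [c] over all cells converts one into the other, and [c] cancels on normalising. *)
Lemma cotree_weightE f : \det (rowsub f P) != 0 ->
  cotree_weight beta E (cotree_of (coim f)) =
  c * (\det (rowsub f (D *m PR)) * \det (rowsub f PR)).
Proof.
move=> df; have finj := det_rowsub_inj df.
rewrite /cotree_weight (cotree_orderE incE QQ' df) cotree_of_dim.
have -> : (absz (\det (rowsub f P)))%:R ^+ 2 = \det (rowsub f PR) ^+ 2 :> R.
  by rewrite map_rowsub_intr det_map_mx natr_absz intr_norm real_normK ?num_real.
set p := \det (rowsub f PR).
rewrite det_rowsub_weighted -/p mulrC.
rewrite [RHS](_ : _ = c * (\prod_i expR (beta * E 0 (f i))) * p ^+ 2); last first.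
  by rewrite expr2 !mulrA.
congr (_ * _).
rewrite /c [X in _ = X * _](bigID [in coim f]) /= -mulrA -[LHS]mulr1; congr (_ * _).
rewrite (eq_bigl [in (f @: [set: 'I_r])%SET]); last by move=> b;
  rewrite /coim !inE negbK.
rewrite big_imset /=; last by move=> i j _ _; exact: finj.
rewrite (eq_bigl predT) => [|i]; last by rewrite inE.
rewrite -big_split /= big1 // => i _.
by rewrite -expRD addNr expR0.
Qed.

Lemma cotree_projR f : \det (rowsub f P) != 0 ->
  map_mx ratr (cotree_rep (cotree_of (coim f))
    (rationalize (hclass (all_cells X) (no_cells X) n z0))) =
  z - PR *m (invmx (rowsub f PR) *m rowsub f z).
Proof.
move=> df; rewrite (cotree_repE incE QQ') // cotree_projE map_mxB !map_mxM map_invmx.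
have e k l (A : 'M[int]_(k, l)) : map_mx ratr (map_mx intr A : 'M[rat]_(_, _)) = map_mx
  intr A :> 'M[R]_(_, _).
  by apply/matrixP => i j; rewrite !mxE; exact: ratr_int.
have er k l g (A : 'M[rat]_(k, l)) : map_mx ratr (rowsub g A) = rowsub g (map_mx ratr
  A) :> 'M[R]_(r, l).
  by apply/matrixP => i j; rewrite !mxE.
by rewrite !er !e.
Qed.

Lemma rfact_n0 : r`!%:R != 0 :> R.
Proof. by rewrite pnatr_eq0 -lt0n fact_gt0. Qed.

Lemma DPT : (D *m PR)^T = PR^T *m D.
Proof. by rewrite trmx_mul tr_diag_mx. Qed.

(** Cauchy-Binet evaluates the normalising sum as [c det G]; its Cramer form evaluates the weighted
    sum of representatives with the adjugate of [G]. The quotient turns the adjugate into the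
    inverse. *)
Lemma boltzmannE :
  boltzmann beta E (hclass (all_cells X) (no_cells X) n z0) =
  z - PR *m (invmx G *m (PR^T *m D *m z)).
Proof.
rewrite /boltzmann !sum_spanning_cotree.
set S0 := \sum_(T | _) _; set S1 := \sum_(T | _) _.
(* Singular blocks occur in Cauchy-Binet but not among co-trees; their terms vanish. *)
have dn0 f : \det (rowsub f P) = 0 -> \det (rowsub f PR) = 0.
  by move=> e; rewrite map_rowsub_intr det_map_mx e.
have S0E : S0 = c * \det G.
  apply: (mulfI rfact_n0); rewrite mulr_natl -(sum_complementary incE QQ' P'P) //.
  rewrite (eq_bigr _ (fun f df => cotree_weightE df)) -big_distrr /= mulrCA -DPT
    -cauchy_binet.
  congr (_ * _); rewrite [LHS]big_mkcond; apply: eq_bigr => f _.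
  by case: eqVneq => //= /dn0 ->; rewrite mulr0.
have S1E : S1 = c *: (\det G *: z - PR *m (\adj G *m (PR^T *m D *m z))).
  apply: (scalerI rfact_n0); rewrite scaler_nat -(sum_complementary incE QQ' P'P) //.
  rewrite scalerA mulrC -scalerA scalerBr -DPT [X in _ - X]scalemxAr.
  rewrite -cauchy_binet_adj scalerA -cauchy_binet.
  rewrite scaler_suml mulmx_sumr -sumrB scaler_sumr [LHS]big_mkcond;
    apply: eq_bigr => f _.
  case: (eqVneq (\det (rowsub f P))) => [/[dup] /dn0 d0|df] /=.
    by move=> _; rewrite det_rowsub_weighted d0 !mulr0 !scale0r mulmx0 subrr scaler0.
  rewrite cotree_weightE // cotree_projR // -!scalerA; congr (_ *: _).
  rewrite -scalemxAr -scalerBr; congr (_ *: _).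
  rewrite scalerBr scalemxAr; congr (_ - _ *m _).
  have fu : rowsub f PR \in unitmx by rewrite unit_rowsub.
  rewrite /invmx fu -scalemxAl scalerA mulfV ?scale1r // -unitfE -unitmxE //.
have Gu := weighted_gram_unit; have dG : \det G != 0 by rewrite -unitfE -unitmxE.
rewrite S0E S1E scalerA invfM mulrC mulrA mulfV ?mul1r; last first.
  by rewrite gt_eqF // prodr_gt0 // => b _; exact: expR_gt0.
by rewrite scalerBr scalerA mulVf // scale1r /invmx Gu -scalemxAl -scalemxAr.
Qed.
End Boltzmann.

(** * Linear ordinary differential equations *)

Section RealCalculus.
Variable R : realType.
Implicit Types (f g df dg : R -> R).

Definition has_derivative f df := forall t : R, is_derive t (1 : R) f (df t).

Lemma derive_continuous f df : has_derivative f df -> continuous f.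
Proof.
move=> fdf t; apply: differentiable_continuous; apply/derivable1_diffP.
exact: ex_derive.
Qed.

Lemma derive_nondecreasing f df a b : a <= b ->
  has_derivative f df ->
  (forall t, a <= t <= b -> 0 <= df t) -> f a <= f b.
Proof.
move=> ab fdf df0.
have [c /[!in_itv]/= cab e] := MVT_segment ab (fun t _ => fdf t)
  (continuous_subspaceT (derive_continuous fdf)).
by rewrite -subr_ge0 e mulr_ge0 ?subr_ge0 ?df0.
Qed.

Lemma derive_bound f df g dg b : 0 <= b ->
  has_derivative f df -> has_derivative g dg ->
  (forall t, 0 <= t <= b -> `|df t| <= dg t) -> `|f b - f 0| <= g b - g 0.
Proof.
move=> b0 fdf gdg dfg; rewrite ler_norml.
have h1 : (g - f) 0 <= (g - f) b.
  apply: (@derive_nondecreasing _ (fun t => dg t - df t)) => // [t|t tb].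
    by apply: is_deriveB.
  by rewrite subr_ge0; apply: le_trans (dfg t tb); exact: ler_norm.
have h2 : (g + f) 0 <= (g + f) b.
  apply: (@derive_nondecreasing _ (fun t => dg t + df t)) => // [t|t tb].
    by apply: is_deriveD.
  have := dfg t tb; rewrite ler_norml => /andP[]; lra.
by move: h1 h2; rewrite /= => h1 h2; apply/andP; split; rewrite ?fctE in h1 h2 *; lra.
Qed.

Lemma is_derive_opp_arg f df : has_derivative f df ->
  has_derivative (fun s => f (- s)) (fun t => - df (- t)).
Proof.
move=> fdf t; have := is_derive1_comp (fdf (- t)) (is_deriveNid t (1 : R)).
by rewrite mulrN1.
Qed.

Lemma is_derive_exp_scale (l : R) :
  has_derivative (fun s => expR (l * s)) (fun t => l * expR (l * t)).
Proof.
move=> t; have := is_derive1_comp (is_derive_expR (l * t)) (is_deriveZ l (is_derive_id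
  t (1 : R))).
by rewrite /GRing.scale /= mulr1 mulrC.
Qed.

(** Measured against [expR (l * |t|)], integration from 0 gains a factor [1 / l], on the whole line
    at once. *)
Lemma exp_growth f df (c l : R) : 0 < l -> 0 <= c -> f 0 = 0 ->
  has_derivative f df ->
  (forall t, `|df t| <= c * l * expR (l * `|t|)) ->
  forall t, `|f t| <= c * expR (l * `|t|).
Proof.
move=> l0 c0 f0 fdf dfc.
have pos h dh : h 0 = 0 -> has_derivative h dh ->
    (forall t, `|dh t| <= c * l * expR (l * `|t|)) ->
    forall t, 0 <= t -> `|h t| <= c * expR (l * `|t|).
  move=> h0 hdh dhc t t0.
  have := @derive_bound h dh (fun s => c * expR (l * s)) (fun s => c * l * expR (l *
    s)) t t0 hdh.
  rewrite h0 subr0 mulr0 expR0 mulr1 (ger0_norm t0) => H.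
  apply: le_trans (H _ _) _; last by rewrite lerBlDr lerDl.
    move=> s; rewrite -mulrA.
    apply: (@is_deriveZ _ _ _ (fun s => expR (l * s)) c s 1 _ (is_derive_exp_scale l
      s)).
  by move=> s /andP[s0 _]; have := dhc s; rewrite (ger0_norm s0).
move=> t; have [t0|t0] := leP 0 t; first exact: (pos f df).
have := pos _ _ _ (is_derive_opp_arg fdf) _ (- t); rewrite opprK normrN; apply.
- by rewrite oppr0.
- by move=> s; rewrite normrN -(normrN s).
- by rewrite oppr_ge0 ltW.
Qed.

(** The integral is differentiated only to the right of its base point [- N]. Subtracting the value
    at 0 removes the dependence on [N], so base points moving with [x] glue to one function on the
    line. *)
Lemma antiderivative f : continuous f ->
  exists2 F, F 0 = 0 & has_derivative F f.
Proof.
move=> fc; pose J N x := (\int[lebesgue_measure]_(t in `]- N, x]) f t)%R : R.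
have fint (N u : R) : lebesgue_measure.-integrable `]- N, u] (EFin \o f).
  have ci : lebesgue_measure.-integrable `[- N, u] (EFin \o f).
    apply: continuous_compact_integrable; first exact: segment_compact.
    exact: continuous_subspaceT.
  apply: (integrableS _ _ _ ci) => //.
  by apply: subset_itvr; rewrite bnd_simp.
have JB (M N x : R) : 0 <= M -> M <= N -> - M <= x -> J N x - J N 0 = J M x - J M 0.
  move=> M0 MN Mx.
  have e y : - M <= y -> J N y = J N (- M) + J M y.
    move=> My; apply/eqP; rewrite addrC -subr_eq; apply/eqP.
    by rewrite /J Rintegral_itvB ?bnd_simp // lerN2.
  by rewrite (e x Mx) (e 0) ?oppr_le0 // opprD addrACA subrr add0r.
exists (fun x => J (`|x| + 1) x - J (`|x| + 1) 0); first by rewrite subrr.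
(* Large enough to exceed [|y| + 1] for every [y] within distance 1 of [x]. *)
move=> x; pose N : R := `|x| + 2.
have JF y : `|x - y| < 1 -> J N y - J N 0 = J (`|y| + 1) y - J (`|y| + 1) 0.
  move=> xy; apply: JB; first by rewrite addr_ge0.
    by rewrite /N; have := le_trans (ler_norm _) (ler_dist_dist y x); move: xy;
      rewrite distrC; lra.
  by rewrite lerNl; apply: le_trans (ler_norm _) _; rewrite normrN lerDl.
apply: (@near_eq_is_derive _ _ _ (fun y => J N y - J N 0)).
  near=> y; apply: JF; near: y.
  exact: (@nbhsx_ballx _ R x 1).
have [dJ J'] : derivable (J N) x 1 /\ derive1 (J N) x = f x.
  apply: (@continuous_FTC1 _ f (BRight (- N)) x (x + 1)) => //.
  - by rewrite ltrDl.
  - have Nx : - N < x by rewrite /N; have := ler_norm (- x); rewrite normrN; lra.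
    exact: Nx.
  - exact: fc.
rewrite -[f x]subr0 -J' derive1E; apply: is_deriveB.
Unshelve. all: by end_near. Qed.

End RealCalculus.

Section GeometricLimit.
Variable R : realType.

Lemma geometric_small (a e : R) : 0 <= a -> 0 < e -> exists n : nat, a / 2 ^+ n < e.
Proof.
move=> a0 e0; exists (Num.truncn (a / e)).+1.
have := truncnS_gt (a / e); set n := _.+1 => an.
rewrite ltr_pdivrMr ?exprn_gt0 //.
rewrite ltr_pdivrMr // in an; apply: lt_le_trans an _.
rewrite mulrC ler_wpM2l ?(ltW e0) // -natrX ler_nat; apply: ltnW; exact: ltn_expl.
Qed.

(** The intervals of radius [2 a / 2 ^ n] about [S n] are nested, because the radius drops by
    exactly [a / 2 ^ n]; the supremum of the left ends lies in all of them. *)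
Lemma geometric_cauchy (S : nat -> R) (a : R) :
  (forall n, `|S n.+1 - S n| <= a / 2 ^+ n) ->
  exists Y, forall n, `|Y - S n| <= 2 * a / 2 ^+ n.
Proof.
move=> Sa; have a0 : 0 <= a by have := le_trans (normr_ge0 _) (Sa 0%N);
  rewrite expr0 divr1.
pose L n := S n - 2 * a / 2 ^+ n; pose U n := S n + 2 * a / 2 ^+ n.
have half n : 2 * a / 2 ^+ n.+1 = a / 2 ^+ n :> R by rewrite exprS; field;
  rewrite expf_neq0.
have LS n : L n <= L n.+1.
  by rewrite /L half; have := Sa n; rewrite ler_norml; lra.
have US n : U n.+1 <= U n.
  by rewrite /U half; have := Sa n; rewrite ler_norml; lra.
have Lmono n k : L n <= L (n + k)%N.
  by elim: k => [|k IH]; rewrite ?addn0 // addnS (le_trans IH).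
have Umono n k : U (n + k)%N <= U n.
  by elim: k => [|k IH]; rewrite ?addn0 // addnS (le_trans _ IH).
have LU1 n : L n <= U n.
  by rewrite /L /U lerD2l ge0_cp // divr_ge0 // ?mulr_ge0 // exprn_ge0.
have LU n k : L n <= U k.
  by rewrite (le_trans (Lmono n k)) // (le_trans (LU1 _)) // addnC Umono.
pose A := range L; have supA : has_sup A.
  by split; [exists (L 0%N); exists 0%N|exists (U 0%N) => _ [n _ <-]; exact: LU].
exists (sup A) => n; rewrite ler_norml; apply/andP; split.
  have : L n <= sup A by apply: sup_upper_bound => //; exists n.
  by rewrite /L; lra.
have : sup A <= U n by apply: ge_sup; [exact: supA.1|move=> _ [k _ <-]; exact: LU].
by rewrite /U; lra.
Qed.

Lemma continuous_approx (f : R -> R) t :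
  (forall e, 0 < e -> exists2 g : R -> R, {for t, continuous g} &
     forall s, `|t - s| < 1 -> `|f s - g s| <= e) -> {for t, continuous f}.
Proof.
move=> H; apply/cvgrPdist_le => e e0.
have e3 : 0 < e / 3 by rewrite divr_gt0.
have [g gc fg] := H _ e3.
move/cvgrPdist_le: gc => /(_ _ e3) gt.
near=> s.
have gts : `|g t - g s| <= e / 3 by near: s.
have ts : `|t - s| < 1 by near: s; exact: (@nbhsx_ballx _ R t 1).
have h1 := fg s ts; have h2 : `|f t - g t| <= e / 3 by apply: fg; rewrite subrr normr0.
by move: gts h1 h2; rewrite !ler_norml; lra.
Unshelve. all: by end_near. Qed.

End GeometricLimit.

Section MatrixCalculus.
Variable R : realType.

Definition continuous_mx m p (M : R -> 'M[R]_(m, p)) :=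
  forall i j, continuous (fun t => M t i j).

Definition has_derivative_mx m p (M dM : R -> 'M[R]_(m, p)) :=
  forall i j, has_derivative (fun t => M t i j) (fun t => dM t i j).

Lemma has_derivative_mxP m p (M dM : R -> 'M[R]_(m, p)) :
  has_derivative_mx M dM <-> forall t, is_derive t (1 : R) M (dM t).
Proof.
split=> [H t|H i j t].
  have dM' : derivable M t 1 by apply/derivable_mxP => i j; have [] := H i j t.
  apply: DeriveDef => //; rewrite derive_mx //; apply/matrixP => i j.
  by rewrite mxE; have [] := H i j t.
have [dM' <-] := H t; apply: DeriveDef; first by move/derivable_mxP: dM'; exact.
by rewrite derive_mx // mxE.
Qed.

Lemma has_derivative_mx_continuous m p (M dM : R -> 'M[R]_(m, p)) :
  has_derivative_mx M dM -> continuous_mx M.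
Proof. by move=> H i j; exact: derive_continuous (H i j). Qed.

Lemma has_derivative_sum k (F dF : 'I_k -> R -> R) :
  (forall i, has_derivative (F i) (dF i)) ->
  has_derivative (fun t => \sum_i F i t) (fun t => \sum_i dF i t).
Proof.
move=> H t; have := is_derive_sum (fun i => H i t).
by congr is_derive; apply/funext => s; rewrite fct_sumE.
Qed.

Lemma has_derivative_mul (f df g dg : R -> R) :
  has_derivative f df -> has_derivative g dg ->
  has_derivative (fun t => f t * g t) (fun t => df t * g t + f t * dg t).
Proof.
move=> fdf gdg t; apply: is_derive_eq; first exact: (is_deriveM (fdf t) (gdg t)).
by rewrite /GRing.scale /= addrC [df t * _]mulrC.
Qed.

Lemma has_derivative_mulmx m k p (A dA : R -> 'M[R]_(m, k)) (B dB : R -> 'M[R]_(k, p)) :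
  has_derivative_mx A dA -> has_derivative_mx B dB ->
  has_derivative_mx (fun t => A t *m B t) (fun t => dA t *m B t + A t *m dB t).
Proof.
move=> HA HB i j; have H := has_derivative_sum (fun l => has_derivative_mul (HA i l)
  (HB l j)).
by congr has_derivative: H; apply/funext => t; rewrite !mxE // -big_split.
Qed.

Lemma has_derivative_mxD m p (A dA B dB : R -> 'M[R]_(m, p)) :
  has_derivative_mx A dA -> has_derivative_mx B dB ->
  has_derivative_mx (fun t => A t + B t) (fun t => dA t + dB t).
Proof.
move=> HA HB i j t; have := is_deriveD (HA i j t) (HB i j t).
by rewrite mxE; congr is_derive; apply/funext => s; rewrite mxE.
Qed.

Lemma has_derivative_mx_cst m p (A : 'M[R]_(m, p)) :
  has_derivative_mx (fun=> A) (fun=> 0).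
Proof. by move=> i j t; rewrite mxE; exact: is_derive_cst. Qed.

Lemma has_derivative_mxZ m p (c : R) (A dA : R -> 'M[R]_(m, p)) :
  has_derivative_mx A dA -> has_derivative_mx (fun t => c *: A t) (fun t => c *: dA t).
Proof.
move=> HA i j t; have := is_deriveZ c (HA i j t).
by rewrite mxE; congr is_derive; apply/funext => s; rewrite mxE.
Qed.

Lemma has_derivative_trmx m p (A dA : R -> 'M[R]_(m, p)) :
  has_derivative_mx A dA -> has_derivative_mx (fun t => (A t)^T) (fun t => (dA t)^T).
Proof.
move=> HA i j t; have := HA j i t; rewrite mxE.
by congr is_derive; apply/funext => s; rewrite mxE.
Qed.

Lemma continuous_sum k (F : 'I_k -> R -> R) :
  (forall i, continuous (F i)) -> continuous (fun t => \sum_i F i t).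
Proof.
elim: k F => [|k IH] F Fc.
  under eq_fun do rewrite big_ord0; exact: cst_continuous.
under eq_fun do rewrite big_ord_recr /=.
by move=> t; apply: continuousD; [exact: IH|exact: Fc].
Qed.

Lemma continuous_mulmx m k p (A : R -> 'M[R]_(m, k)) (B : R -> 'M[R]_(k, p)) :
  continuous_mx A -> continuous_mx B -> continuous_mx (fun t => A t *m B t).
Proof.
move=> Ac Bc i j; under eq_fun do rewrite mxE.
by apply: continuous_sum => l t; apply: continuousM; [exact: Ac|exact: Bc].
Qed.

Lemma continuous_mxD m p (A B : R -> 'M[R]_(m, p)) :
  continuous_mx A -> continuous_mx B -> continuous_mx (fun t => A t + B t).
Proof.
move=> Ac Bc i j; under eq_fun do rewrite mxE.
by move=> t; apply: continuousD; [exact: Ac|exact: Bc].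
Qed.

End MatrixCalculus.

(** * Global solutions of linear systems *)

Section LinearODE.
Variable R : realType.

Lemma normr_entry_le_sum m k (A : 'M[R]_(m, k)) i j :
  `|A i j| <= \sum_i \sum_j `|A i j|.
Proof.
rewrite (bigD1 i) //= (bigD1 j) //= -addrA lerDl addr_ge0 ?sumr_ge0 // => ? _.
by rewrite sumr_ge0.
Qed.

Lemma mulmx_bound m k p (A : 'M[R]_(m, k)) (B : 'M[R]_(k, p)) (a b : R) :
  (forall i j, `|A i j| <= a) -> (forall i j, `|B i j| <= b) ->
  forall i j, `|(A *m B) i j| <= k%:R * (a * b).
Proof.
move=> Aa Bb i j; rewrite mxE; apply: le_trans (ler_norm_sum _ _ _) _.
apply: (@le_trans _ _ (\sum_(l < k) a * b)); last first.
  by rewrite sumr_const card_ord mulr_natl.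
by apply: ler_sum => l _ /=; rewrite normrM ler_pM.
Qed.

Lemma antiderivative_mx m p (F : R -> 'M[R]_(m, p)) (Y0 : 'M[R]_(m, p)) :
  continuous_mx F -> exists2 Z, Z 0 = Y0 & has_derivative_mx Z F.
Proof.
move=> Fc; pose H i j := cid2 (antiderivative (Fc i j)).
exists (fun t => \matrix_(i, j) (Y0 i j + s2val (H i j) t)).
  by apply/matrixP => i j; rewrite mxE (s2valP (H i j)) addr0.
move=> i j t; have := is_deriveD (is_derive_cst (Y0 i j) t (1 : R)) (s2valP' (H i j) t).
by rewrite add0r; congr is_derive; apply/funext => s; rewrite mxE.
Qed.

Variables (m p : nat) (N : R -> 'M[R]_m) (C : R -> 'M[R]_(m, p)).
Variables (nu kappa : R).
Hypothesis Nc : continuous_mx N.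
Hypothesis Cc : continuous_mx C.
Hypothesis Nnu : forall t i j, `|N t i j| <= nu.
Hypothesis Ckappa : forall t i j, `|C t i j| <= kappa.

(* Picard iteration; the weight expR (l * `|t|) with l >= 2 m nu turns the
   integral operator into a contraction of ratio 1/2. *)
Lemma linear_ode (Y0 : 'M[R]_(m, p)) : exists2 Y,
  Y 0 = Y0 & has_derivative_mx Y (fun t => N t *m Y t + C t).
Proof.
have fc Y : continuous_mx Y -> continuous_mx (fun t => N t *m Y t + C t).
  by move=> Yc; apply: continuous_mxD => //; exact: continuous_mulmx.
(* Picard's operator, specified only on continuous [Y]; elsewhere its value is arbitrary. *)
have /choice[stp stpP] (Y : R -> 'M[R]_(m, p)) : exists Z, continuous_mx Y ->
    Z 0 = Y0 /\ has_derivative_mx Z (fun t => N t *m Y t + C t).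
  have [Yc|nYc] := pselect (continuous_mx Y); last by exists Y.
  by have [Z Z0 dZ] := antiderivative_mx Y0 (fc Y Yc); exists Z.
pose S n := iter n stp (fun=> Y0).
have Sc n : continuous_mx (S n).
  elim: n => [|n IH]; first by move=> i j; exact: cst_continuous.
  exact: has_derivative_mx_continuous (stpP _ IH).2.
have S0 n : S n 0 = Y0 by case: n => [|n] //; exact: (stpP _ (Sc n)).1.
have [y0 Y0y] : exists y0, forall i j, `|Y0 i j| <= y0.
  by exists (\sum_i \sum_j `|Y0 i j|); exact: normr_entry_le_sum.
(* [q] bounds the action of [N] on entries, [l] satisfies [q <= l / 2], and [c] bounds the first
   increment [N Y0 + C]. *)
pose q := m%:R * `|nu|; pose l := 2 * q + 1; pose c := `|q * y0| + `|kappa|.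
have q0 : 0 <= q by rewrite mulr_ge0.
have l0 : 0 < l by rewrite /l; lra.
have c0 : 0 <= c by rewrite addr_ge0.
have Nb t (Z : 'M[R]_(m, p)) b : (forall i j, `|Z i j| <= b) ->
    forall i j, `|(N t *m Z) i j| <= q * b.
  move=> Zb i j; rewrite /q -mulrA; apply: mulmx_bound => // i' j'.
  exact: le_trans (Nnu t i' j') (ler_norm _).
have contr (Z W U V : R -> 'M[R]_(m, p)) (a : R) : 0 <= a -> Z 0 = W 0 ->
    has_derivative_mx Z (fun t => N t *m U t + C t) ->
    has_derivative_mx W (fun t => N t *m V t + C t) ->
    (forall t i j, `|U t i j - V t i j| <= a * expR (l * `|t|)) ->
    forall t i j, `|Z t i j - W t i j| <= a / 2 * expR (l * `|t|).
  move=> a0 ZW0 dZ' dW' UV t i j.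
  apply: (@exp_growth R (fun t => Z t i j - W t i j)
    (fun t => (N t *m (U t - V t)) i j) (a / 2) l) => //.
  - by rewrite divr_ge0.
  - by rewrite ZW0 subrr.
  - move=> s; apply: is_derive_eq; first exact: (is_deriveB (dZ' i j s) (dW' i j s)).
    by rewrite mulmxBr !mxE opprD addrACA subrr addr0.
  - move=> s; apply: le_trans (Nb _ _ (a * expR (l * `|s|)) _ _ _) _.
      by move=> i' j'; rewrite !mxE.
    rewrite mulrA ler_wpM2r ?expR_ge0 // /l; nra.
have Sdiff n t i j : `|S n.+1 t i j - S n t i j| <= c * expR (l * `|t|) / 2 ^+ n.
  elim: n t i j => [|n IH] t i j.
    rewrite expr0 divr1; apply: (@exp_growth R (fun t => S 1%N t i j - S 0%N t i j)
      (fun t => (N t *m Y0 + C t) i j)) => //.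
    - by rewrite !S0 subrr.
    - move=> s; apply: is_derive_eq.
        exact: (is_deriveB ((stpP _ (Sc 0%N)).2 i j s) (is_derive_cst (Y0 i j) s (1 :
          R))).
      by rewrite subr0.
    - move=> s; rewrite mxE; apply: le_trans (ler_normD _ _) _.
      have h1 := Nb s Y0 y0 Y0y i j; have h2 := Ckappa s i j.
      have e1 : 1 <= expR (l * `|s|) by rewrite -expR0 ler_expR mulr_ge0 // ltW.
      have h3 : c <= c * l by rewrite /l; nra.
      have h4 : c * l <= c * l * expR (l * `|s|) by rewrite ler_peMr // mulr_ge0 // ltW.
      apply: le_trans h4; apply: le_trans h3; apply: lerD.
        exact: le_trans h1 (ler_norm _).
      exact: le_trans h2 (ler_norm _).
  rewrite (_ : c * _ / _ = c / 2 ^+ n / 2 * expR (l * `|t|)); last first.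
    by rewrite exprS invfM; ring.
  apply: (contr (S n.+2) (S n.+1) (S n.+1) (S n) (c / 2 ^+ n)).
  - by rewrite divr_ge0 // exprn_ge0.
  - by rewrite !S0.
  - exact: (stpP _ (Sc n.+1)).2.
  - exact: (stpP _ (Sc n)).2.
  - by move=> t' i' j'; rewrite mulrAC IH.
have [Y YS] : exists Y : R -> 'M[R]_(m, p), forall t i j n,
    `|Y t i j - S n t i j| <= 2 * (c * expR (l * `|t|)) / 2 ^+ n.
  pose H t i j := cid (geometric_cauchy (fun n => Sdiff n t i j)).
  by exists (fun t => \matrix_(i, j) projT1 (H t i j)) => t i j n; rewrite mxE;
    exact: projT2 (H t i j) n.
(* The error grows with [|s|], but within distance 1 of [t] it is controlled with [|t| + 1] in the
   exponent: locally [Y] is a uniform limit. *)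
have Yc : continuous_mx Y.
  move=> i j t; apply: continuous_approx => e e0.
  have [n ne] := @geometric_small _ (2 * (c * expR (l * (`|t| + 1)))) e (mulr_ge0
    (ler0n _ 2) (mulr_ge0 c0 (expR_ge0 _))) e0.
  exists (fun s => S n s i j); first exact: Sc.
  move=> s ts; apply: le_trans (YS _ _ _ _) _; apply: ltW; apply: le_lt_trans ne.
  rewrite ler_pM2r ?invr_gt0 ?exprn_gt0 // ler_pM2l // ler_wpM2l // ler_expR.
  rewrite ler_pM2l //; have := le_trans (ler_norm _) (ler_dist_dist s t).
  by move: ts; rewrite distrC; lra.
have [Z0 dZ] := stpP Y Yc.
(* Both [stp Y] and [Y] are within [w], defined below, of [S n.+1], and [w] tends to 0 with growing
   [n]. *)
suff ZY : stp Y = Y by exists Y; [rewrite -ZY|move: dZ; rewrite ZY].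
apply/funext => t; apply/matrixP => i j; apply/eqP; rewrite -subr_eq0 -normr_eq0.
rewrite eq_le normr_ge0 andbT; apply/ler_addgt0Pl => e e0; rewrite addr0.
have [n ne] := @geometric_small _ (4 * (c * expR (l * `|t|))) e (mulr_ge0 (ler0n _ 4)
  (mulr_ge0 c0 (expR_ge0 _))) e0.
have h1 := YS t i j n.+1.
have := contr (stp Y) (S n.+1) Y (S n) (2 * c / 2 ^+ n).
move=> /(_ _ _ dZ (stpP _ (Sc n)).2) h2.
have {}h2 : `|stp Y t i j - S n.+1 t i j| <= 2 * c / 2 ^+ n / 2 * expR (l * `|t|).
  apply: h2; [by rewrite divr_ge0 ?exprn_ge0 // mulr_ge0|by rewrite S0 Z0|].
  move=> s i' j'; apply: le_trans (YS _ _ _ _) _.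
  by rewrite mulrA mulrAC.
pose w := c * expR (l * `|t|) / 2 ^+ n.
have p2 : 2 ^+ n != 0 :> R by rewrite expf_neq0.
have w0 : 0 <= w by rewrite divr_ge0 ?exprn_ge0 // mulr_ge0 ?expR_ge0.
have e1 : 2 * (c * expR (l * `|t|)) / 2 ^+ n.+1 = w by rewrite /w exprS; field.
have e2 : 2 * c / 2 ^+ n / 2 * expR (l * `|t|) = w by rewrite /w; field.
have e4 : 4 * (c * expR (l * `|t|)) / 2 ^+ n = 4 * w by rewrite /w; field.
by move: h1 h2 ne; rewrite e1 e2 e4 !ler_norml; lra.
Qed.

End LinearODE.

(** * Periodic solutions in the adiabatic limit *)

Section Periodic.
Variable R : realType.

Lemma periodic_nat V (f : R -> V) : periodic f -> forall (n : nat) t, f (t + n%:R) = f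
  t.
Proof.
move=> fp; elim=> [|n IH] t; first by rewrite addr0.
by rewrite -addn1 natrD addrA fp.
Qed.

Lemma periodic_unit_interval V (f : R -> V) : periodic f ->
  forall t, exists2 s, s \in `[0, 1] & f t = f s.
Proof.
move=> fp t; exists (t - (Num.floor t)%:~R).
  rewrite in_itv /= subr_ge0 floor_le /= lerBlDl ltW //.
  by have := floorD1_gt t; rewrite intrD.
case: (Num.floor t) => n; first by rewrite -[t in LHS](subrK n%:R) periodic_nat.
by rewrite NegzE mulrNz opprK -(periodic_nat fp n.+1 t).
Qed.

Lemma periodic_max (f : R -> R) : continuous f -> periodic f ->
  exists c, forall t, f t <= f c.
Proof.
move=> fc fp; have [c _ cmax] := EVT_max (ler01 : 0 <= 1 :> R) (continuous_subspaceT
  fc).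
by exists c => t; have [s s01 ->] := periodic_unit_interval fp t; exact: cmax.
Qed.

Lemma periodic_bounded (f : R -> R) : continuous f -> periodic f ->
  exists M, forall t, `|f t| <= M.
Proof.
move=> fc fp; have [c cmax] := @periodic_max (fun t => `|f t|)
  (fun t => continuous_comp (fc t) (@norm_continuous _ _ (f t))) (fun t => congr1 _ (fp
    t)).
by exists (`|f c|).
Qed.

Lemma periodic_bounded_mx m p (M : R -> 'M[R]_(m, p)) : continuous_mx M -> periodic M ->
  exists K, forall t i j, `|M t i j| <= K.
Proof.
move=> Mc Mp.
have H i j : exists K, forall t, `|M t i j| <= K.
  by apply: periodic_bounded => [|t]; [exact: Mc|rewrite Mp].
exists (\sum_i \sum_j projT1 (cid (H i j))) => t i j.
have K0 i' j' : 0 <= projT1 (cid (H i' j')).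
  by case: cid => /= K hK; exact: le_trans (normr_ge0 _) (hK 0).
rewrite (bigD1 i) //= (bigD1 j) //= -addrA.
apply: (le_trans (projT2 (cid (H i j)) t)).
rewrite lerDl addr_ge0 //; first by rewrite sumr_ge0 // => *; exact: K0.
by rewrite sumr_ge0 // => ? _; rewrite sumr_ge0 // => *; exact: K0.
Qed.

Lemma derivative_at_max (f df : R -> R) c : has_derivative f df ->
  (forall t, f t <= f c) -> df c = 0.
Proof.
move=> fdf fmax.
have [] := @derive1_at_max _ f (c - 1) (c + 1) c.
- by rewrite lerD2l; lra.
- by move=> t _; have [] := fdf t.
- by rewrite in_itv /=; apply/andP; split; lra.
- by move=> t _; exact: fmax.
by move=> _ <-; have [_ ->] := fdf c.
Qed.

(** [v e^(-Ct)] is nonincreasing, which settles [t >= 0]; [v e^(Ct)] is nondecreasing, which settles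
    [t <= 0]. *)
Lemma gronwall_zero (v dv : R -> R) C : has_derivative v dv ->
  (forall t, `|dv t| <= C * v t) -> v 0 = 0 -> forall t, v t <= 0.
Proof.
move=> vdv dvC v0 t.
have H (l : R) : has_derivative (fun t => v t * expR (l * t))
   (fun t => dv t * expR (l * t) + v t * (l * expR (l * t))).
  exact: has_derivative_mul vdv (is_derive_exp_scale l).
have [t0|t0] := leP 0 t.
  have := @derive_nondecreasing R (fun t => - (v t * expR (- C * t)))
    (fun t => - (dv t * expR (- C * t) + v t * (- C * expR (- C * t)))) 0 t t0.
  rewrite v0 mul0r oppr0 oppr_ge0 => H'; rewrite -(pmulr_lle0 _ (expR_gt0 (- C * t)));
    apply: H'.
  - by move=> s; apply: is_deriveN; exact: H.
  - move=> s _; have := expR_ge0 (- C * s); have := dvC s; rewrite ler_norml.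
    move: (expR _) => E; nra.
have := @derive_nondecreasing R (fun t => v t * expR (C * t)) _ t 0 (ltW t0) (H C).
rewrite v0 mul0r => H'; rewrite -(pmulr_lle0 _ (expR_gt0 (C * t))); apply: H'.
- move=> s _; have := expR_ge0 (C * s); have := dvC s; rewrite ler_norml.
  move: (expR _) => E; nra.
Qed.

End Periodic.

(** * Euclidean inner product and uniform operator bounds *)

Section Dot.
Variable R : realType.

Definition dot k (x y : 'cV[R]_k) : R := (x^T *m y) 0 0.

Lemma dotE k (x y : 'cV[R]_k) : dot x y = \sum_i x i 0 * y i 0.
Proof. by rewrite /dot mxE; apply: eq_bigr => i _; rewrite mxE. Qed.

Lemma dotC k (x y : 'cV[R]_k) : dot x y = dot y x.
Proof. by rewrite !dotE; apply: eq_bigr => i _; rewrite mulrC. Qed.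

Lemma dotDl k (x y z : 'cV[R]_k) : dot (x + y) z = dot x z + dot y z.
Proof. by rewrite /dot linearD /= mulmxDl mxE. Qed.

Lemma dotDr k (x y z : 'cV[R]_k) : dot z (x + y) = dot z x + dot z y.
Proof. by rewrite /dot mulmxDr mxE. Qed.

Lemma dotZl k (a : R) (x z : 'cV[R]_k) : dot (a *: x) z = a * dot x z.
Proof. by rewrite /dot linearZ /= -scalemxAl mxE. Qed.

Lemma dotZr k (a : R) (x z : 'cV[R]_k) : dot z (a *: x) = a * dot z x.
Proof. by rewrite dotC dotZl dotC. Qed.

Lemma dot_mulmx k l (A : 'M[R]_(k, l)) x y : dot x (A *m y) = dot (A^T *m x) y.
Proof. by rewrite /dot trmx_mul trmxK mulmxA. Qed.

Lemma dot_ge0 k (x : 'cV[R]_k) : 0 <= dot x x.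
Proof. by rewrite dotE sumr_ge0 // => i _; rewrite -expr2 sqr_ge0. Qed.

Lemma sqr_le_dot k (x : 'cV[R]_k) i : x i 0 ^+ 2 <= dot x x.
Proof.
rewrite dotE (bigD1 i) //= -expr2 lerDl sumr_ge0 // => j _.
by rewrite -expr2 sqr_ge0.
Qed.

Lemma dot_le0 k (x : 'cV[R]_k) : dot x x <= 0 -> x = 0.
Proof.
move=> x0; apply/matrixP => i j; rewrite ord1 mxE; apply/eqP; rewrite -sqrf_eq0.
by rewrite eq_le sqr_ge0 andbT (le_trans (sqr_le_dot x i)).
Qed.

Lemma dot_young k (x y : 'cV[R]_k) : 2 * dot x y <= dot x x + dot y y.
Proof.
have := dot_ge0 (x + -1 *: y); rewrite !dotDl !dotDr !dotZl !dotZr (dotC y x).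
lra.
Qed.

Lemma dotD_le k (x y : 'cV[R]_k) : dot (x + y) (x + y) <= 2 * dot x x + 2 * dot y y.
Proof. by have := dot_young x y; rewrite !dotDl !dotDr (dotC y x); lra. Qed.

Lemma dotN k (x y : 'cV[R]_k) : dot (- x) (- y) = dot x y.
Proof. by rewrite -(scaleN1r x) -(scaleN1r y) dotZl dotZr mulrA mulrNN !mul1r. Qed.

(** [c] is chosen before [A] and depends only on the sizes and the entry bound, so it serves a whole
    periodic family of matrices. *)
Lemma dot_mulmx_bound k l (a : R) : exists2 c, 0 <= c &
  forall A : 'M[R]_(k, l), (forall i j, `|A i j| <= a) ->
  forall x, dot (A *m x) (A *m x) <= c * dot x x.
Proof.
exists (k%:R * (l%:R * a ^+ 2)); first by rewrite mulr_ge0 // mulr_ge0 // sqr_ge0.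
move=> A Aa x; rewrite dotE.
have sq (y : 'I_l -> R) : (\sum_j y j) * (\sum_j y j) <= l%:R * \sum_j y j ^+ 2.
  rewrite mulr_suml.
  apply: (@le_trans _ _ (\sum_i \sum_j (y i ^+ 2 + y j ^+ 2) / 2)).
    apply: ler_sum => i _; rewrite mulr_sumr; apply: ler_sum => j _.
    by have := sqr_ge0 (y i - y j); rewrite !expr2; lra.
  under eq_bigr do rewrite -mulr_suml big_split /= sumr_const card_ord.
  by rewrite -mulr_suml big_split /= sumr_const card_ord sumrMnl -(mulr_natl _ l); lra.
apply: (@le_trans _ _ (\sum_(i < k) l%:R * a ^+ 2 * dot x x)).
  apply: ler_sum => i _; rewrite mxE; apply: le_trans (sq _) _.
  rewrite -mulrA ler_wpM2l // dotE mulr_sumr; apply: ler_sum => j _.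
  rewrite exprMn -expr2 ler_wpM2r ?sqr_ge0 // -real_normK ?num_real //.
  by rewrite lerXn2r ?nnegrE // ?(le_trans (normr_ge0 _) (Aa i j)).
by rewrite sumr_const card_ord -[leLHS]mulr_natl !mulrA.
Qed.

End Dot.

Section LinearPeriodic.
Variable R : realType.

Lemma has_derivative_mx_shift m p (Y dY : R -> 'M[R]_(m, p)) :
  has_derivative_mx Y dY ->
  has_derivative_mx (fun t => Y (t + 1)) (fun t => dY (t + 1)).
Proof.
move=> H i j t; have := @is_derive1_comp _ _ (shift 1) t _ _ (H i j (t + 1))
  (is_derive_shift t (1 : R) 1).
by rewrite mulr1.
Qed.

Lemma linear_ivp_unique m (N : R -> 'M[R]_m) (nu : R) (w : R -> 'cV[R]_m) :
  (forall t i j, `|N t i j| <= nu) ->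
  has_derivative_mx w (fun t => N t *m w t) -> w 0 = 0 -> forall t, w t = 0.
Proof.
move=> Nnu dw w0 t; apply: dot_le0.
have [c c0 hc] := dot_mulmx_bound m m nu.
pose dv t := dot (N t *m w t) (w t) + dot (w t) (N t *m w t).
(* Young's inequality bounds [|2 w . N w|] by [|N w|^2 + |w|^2], whence the constant [1 + c]. *)
apply: (@gronwall_zero R (fun t => dot (w t) (w t)) dv (1 + c)) t.
- move=> t; have := has_derivative_mulmx (has_derivative_trmx dw) dw 0 0 t.
  by rewrite mxE.
- move=> t; rewrite /dv (dotC (w t)); have h1 := dot_young (N t *m w t) (w t).
  have h2 := dot_young (N t *m w t) (- w t).
  have h3 := hc (N t) (Nnu t) (w t).
  rewrite dotN -scaleN1r dotZr in h2; rewrite ler_norml; lra.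
- by rewrite w0 /dot mulmx0 mxE.
Qed.

(* The periodic solution is Phi v + y0, with Phi the fundamental solution, y0
   the solution vanishing at 0 and v the solution of (1 - Phi 1) v = y0 1. *)
Lemma periodic_linear_ode m (N : R -> 'M[R]_m) (C : R -> 'cV[R]_m) :
  continuous_mx N -> continuous_mx C -> periodic N -> periodic C ->
  (forall w : R -> 'cV[R]_m, periodic w ->
     has_derivative_mx w (fun t => N t *m w t) -> forall t, w t = 0) ->
  exists2 y, periodic y & has_derivative_mx y (fun t => N t *m y t + C t).
Proof.
move=> Nc Cc Np Cp hom.
have [nu Nnu] := periodic_bounded_mx Nc Np.
have [kappa Ck] := periodic_bounded_mx Cc Cp.
have [y0 y00 dy0] := linear_ode Nc Cc Nnu Ck 0.
have c0 : continuous_mx (fun=> 0 : 'M[R]_m) by move=> i j; exact: cst_continuous.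
have k0 (t : R) i j : `|(0 : 'M[R]_m) i j| <= 0 by rewrite mxE normr0.
have [Phi Phi0 dPhi] := linear_ode Nc c0 Nnu k0 1%:M.
have dPhiv (v : 'cV[R]_m) : has_derivative_mx (fun t => Phi t *m v) (fun t => N t *m
  (Phi t *m v)).
  move=> i j t; have := has_derivative_mulmx dPhi (has_derivative_mx_cst v) i j t.
  by rewrite addr0 mulmx0 addr0 mulmxA.
(* [x (t + 1) - x t] solves the homogeneous equation, so its vanishing at 0 propagates. *)
have perio (c : R -> 'cV[R]_m) (x : R -> 'cV[R]_m) : periodic c ->
    has_derivative_mx x (fun t => N t *m x t + c t) -> x 1 = x 0 -> periodic x.
  move=> cp dx x10 t; apply/eqP; rewrite -subr_eq0; apply/eqP.
  apply: (@linear_ivp_unique m N nu (fun t => x (t + 1) - x t)) => //; last first.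
    by rewrite add0r x10 subrr.
  move=> i j s; have := has_derivative_mxD (has_derivative_mx_shift dx)
    (has_derivative_mxZ (-1) dx) i j s.
  congr is_derive; first by apply/funext => u; rewrite scaleN1r.
  by rewrite Np cp scaleN1r opprD addrACA subrr addr0 -mulmxBr.
(* A kernel vector of [1 - Phi 1] would start a periodic homogeneous solution. *)
have unit1 : 1%:M - Phi 1 \in unitmx.
  rewrite unitmxE unitfE -det_tr; apply/det0P => -[v vn0 vf].
  have Pv : Phi 1 *m v^T = v^T.
    apply/esym/eqP; rewrite -subr_eq0 -{1}[v^T]mul1mx -mulmxBl.
    by rewrite -[_ *m _]trmxK trmx_mul trmxK vf trmx0.
  case/eqP: vn0; apply: trmx_inj; rewrite trmx0.
  have := hom (fun t => Phi t *m v^T) _ (dPhiv _) 0; rewrite Phi0 mul1mx; apply.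
  apply: (perio (fun=> 0)) => //; last by rewrite Pv Phi0 mul1mx.
  by move=> i j t; rewrite addr0; exact: dPhiv.
pose v := invmx (1%:M - Phi 1) *m y0 1.
have dy : has_derivative_mx (fun t => Phi t *m v + y0 t)
    (fun t => N t *m (Phi t *m v + y0 t) + C t).
  move=> i j t; have := has_derivative_mxD (dPhiv v) dy0 i j t.
  by rewrite mulmxDr addrA.
exists (fun t => Phi t *m v + y0 t) => //; apply: (perio C) => //.
have -> : y0 1 = v - Phi 1 *m v by rewrite -{1}[v]mul1mx -mulmxBl mulKVmx.
by rewrite y00 addr0 Phi0 mul1mx addrC subrK.
Qed.

End LinearPeriodic.

(** * Lyapunov estimate for the fast variable *)

Section SlowManifold.
Variables (R : realType) (r : nat) (A dA G dG : R -> 'M[R]_r) (a k : R).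
Hypothesis a0 : 0 < a.
Hypothesis k0 : 0 <= k.
Hypothesis AdA : has_derivative_mx A dA.
Hypothesis GdG : has_derivative_mx G dG.
Hypothesis Asym : forall t, (A t)^T = A t.
Hypothesis Age : forall t x, a * dot x x <= dot x (A t *m x).
Hypothesis Gge : forall t x, a * dot x x <= dot x (G t *m x).
Hypothesis Ale : forall t x, dot (A t *m x) (A t *m x) <= k * dot x x.
Hypothesis dAle : forall t x, dot (dA t *m x) (dA t *m x) <= k * dot x x.
Hypothesis dGle : forall t x, dot (dG t *m x) (dG t *m x) <= k * dot x x.
Hypothesis Ap : periodic A.
Hypothesis Gp : periodic G.

(** A common majorant for the coefficients of [|g|^2], [|b|^2] and [|b'|^2] in [critical_estimate].
    The term [4 * k / a ^+ 2] is the price of bounding [y] by [g] and [b]. *)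
Definition slow_cost : R := 2 * k + 3 + 4 * k / a ^+ 2.

(** Young's inequality for [a x] and [M x] takes the place of Cauchy-Schwarz and avoids square
    roots. *)
Lemma coercive_sqr (M : 'M[R]_r) (x : 'cV[R]_r) : a * dot x x <= dot x (M *m x) ->
  a ^+ 2 * dot x x <= dot (M *m x) (M *m x).
Proof.
move=> ax; have := dot_young (a *: x) (M *m x); rewrite !dotZl !dotZr => h.
have : 2 * (a * (a * dot x x)) <= 2 * (a * dot x (M *m x)).
  by rewrite ler_pM2l // ler_pM2l.
by rewrite expr2 -mulrA; lra.
Qed.

Lemma slow_cost_ge0 : 0 <= slow_cost.
Proof.
have a2 : 0 < a ^+ 2 by rewrite exprn_gt0.
by rewrite /slow_cost !addr_ge0 ?divr_ge0 ?mulr_ge0 // ltW.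
Qed.

(** The hypothesis is [V' = 0] for [V = g . A g]. It balances the fast term [2 tau x . G x], with
    [x = A g], against terms without [tau]; the former is at least [2 tau a^3 |g|^2], by coercivity
    of [G] at [x] and of [A] at [g]. *)
Lemma critical_estimate tau t (y b db : 'cV[R]_r) : 0 <= tau ->
  let g := G t *m y + b in
  let dg := dG t *m y + db + G t *m (- tau *: (A t *m g)) in
  2 * dot (A t *m g) dg + dot g (dA t *m g) = 0 ->
  (2 * tau * a ^+ 3 - slow_cost) * dot g g <= slow_cost * (dot b b + dot db db).
Proof.
move=> tau0 g dg; set u := dG t *m y + db in dg *; rewrite /dg.
rewrite dotDr -scalemxAr dotZr => crit.
set x := A t *m g in crit *.
have h1 : a * dot x x <= dot x (G t *m x) := Gge t x.
have h2 : a ^+ 2 * dot g g <= dot x x := coercive_sqr (Age t g).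
have h3 : dot x x <= k * dot g g := Ale t g.
have h4 := dot_young x u.
have h5 := dot_young g (dA t *m g).
have h6 : dot (dA t *m g) (dA t *m g) <= k * dot g g := dAle t g.
have h7 : dot u u <= 2 * dot (dG t *m y) (dG t *m y) + 2 * dot db db := dotD_le _ _.
have h8 : dot (dG t *m y) (dG t *m y) <= k * dot y y := dGle t y.
have h9 : a ^+ 2 * dot y y <= dot (G t *m y) (G t *m y) := coercive_sqr (Gge t y).
(* [y] has no a priori bound; it is controlled through [G y = g - b] and the coercivity of [G]. *)
have h10 : dot (G t *m y) (G t *m y) <= 2 * dot g g + 2 * dot b b.
  have -> : G t *m y = g + - b by rewrite addrK.
  by have := dotD_le g (- b); rewrite dotN.
have a2 : 0 < a ^+ 2 by rewrite exprn_gt0.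
have h11 : dot y y <= (2 * dot g g + 2 * dot b b) / a ^+ 2.
  by rewrite ler_pdivlMr // mulrC; exact: le_trans h9 h10.
have h12 : k * dot y y <= k * ((2 * dot g g + 2 * dot b b) / a ^+ 2) by rewrite
  ler_wpM2l.
have h13 : tau * (a * (a ^+ 2 * dot g g)) <= tau * dot x (G t *m x).
  by rewrite ler_wpM2l // (le_trans _ h1) // ler_pM2l.
have b0 := dot_ge0 b; have db0 := dot_ge0 db; have g0 := dot_ge0 g.
have kb : 0 <= k / a ^+ 2 * dot db db by rewrite mulr_ge0 // divr_ge0 // ltW.
have e3 : a ^+ 3 = a * a ^+ 2 by rewrite exprS.
have h14 : k * ((2 * dot g g + 2 * dot b b) / a ^+ 2) =
   2 * (k / a ^+ 2 * dot g g) + 2 * (k / a ^+ 2 * dot b b) by ring.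
have kb0 : 0 <= k * dot b b by rewrite mulr_ge0.
have kdb0 : 0 <= k * dot db db by rewrite mulr_ge0.
have -> : (2 * tau * a ^+ 3 - slow_cost) * dot g g =
  2 * (tau * (a * (a ^+ 2 * dot g g))) - (2 * (k * dot g g) + 3 * dot g g + 4 * (k / a
    ^+ 2 * dot g g)).
  by rewrite /slow_cost e3; ring.
have -> : slow_cost * (dot b b + dot db db) =
  (2 * (k * dot b b) + 3 * dot b b + 4 * (k / a ^+ 2 * dot b b)) +
  (2 * (k * dot db db) + 3 * dot db db + 4 * (k / a ^+ 2 * dot db db)).
  by rewrite /slow_cost; ring.
have kg0 : 0 <= k / a ^+ 2 * dot b b by rewrite mulr_ge0 // divr_ge0 // ltW.
rewrite {}h14 in h12; rewrite mulNr in crit.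
have lin (xu txGx gdAg xx gg uu dAg dGy ddb yy bb t3 qdb qb qg kb1 kdb : R) :
    2 * (xu - txGx) + gdAg = 0 -> xx <= k * gg -> 2 * xu <= xx + uu ->
    2 * gdAg <= gg + dAg -> dAg <= k * gg -> uu <= 2 * dGy + 2 * ddb ->
    dGy <= k * yy -> t3 <= txGx -> 0 <= bb -> 0 <= ddb -> 0 <= gg -> 0 <= k * gg ->
    0 <= kb1 -> 0 <= kdb ->
    k * yy <= 2 * qg + 2 * qb -> 0 <= qdb -> 0 <= qb ->
    2 * t3 - (2 * (k * gg) + 3 * gg + 4 * qg) <=
    2 * kb1 + 3 * bb + 4 * qb + (2 * kdb + 3 * ddb + 4 * qdb) by lra.
have kgg0 : 0 <= k * dot g g by rewrite mulr_ge0.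
exact (lin _ _ _ _ _ _ _ _ _ _ _ _ _ _ _ _ _ crit h3 h4 h5 h6 h7 h8 h13 b0 db0 g0 kgg0
  kb0 kdb0 h12 kb kg0).
Qed.

(* Evaluated at the maximum over one period of the Lyapunov function
   V = g . A g, so that no integration of V' is needed. *)
Lemma slow_manifold_bound tau (b db y : R -> 'cV[R]_r) M :
  0 <= tau -> slow_cost <= 2 * tau * a ^+ 3 ->
  periodic b -> has_derivative_mx b db ->
  (forall t, dot (b t) (b t) + dot (db t) (db t) <= M) ->
  periodic y ->
  has_derivative_mx y (fun t => - tau *: (A t *m (G t *m y t + b t))) ->
  forall t, a * (2 * tau * a ^+ 3 - slow_cost) *
     dot (G t *m y t + b t) (G t *m y t + b t) <= (1 + k) * slow_cost * M.
Proof.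
move=> tau0 tauk bp bdb bM yp dy t.
pose g t := G t *m y t + b t.
pose dg t := dG t *m y t + db t + G t *m (- tau *: (A t *m g t)).
have gdg : has_derivative_mx g dg.
  move=> i j s; have := has_derivative_mxD (has_derivative_mulmx GdG dy) bdb i j s.
  by rewrite /dg addrAC.
pose V t := dot (g t) (A t *m g t).
pose dV t := 2 * dot (A t *m g t) (dg t) + dot (g t) (dA t *m g t).
have VdV : has_derivative V dV.
  move=> s; apply: is_derive_eq.
    exact: (has_derivative_mulmx (has_derivative_trmx gdg) (has_derivative_mulmx AdA
      gdg) 0 0 s).
  rewrite mxE /dV -/(dot (dg s) (A s *m g s)) -/(dot (g s) (dA s *m g s + A s *m dg s)).
  by rewrite dotDr (dotC (dg s)) [dot (g s) (A s *m dg s)]dot_mulmx Asym; ring.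
have gp : periodic g by move=> s; rewrite /g Gp yp bp.
have [c cmax] : exists c, forall s, V s <= V c.
  apply: periodic_max; first exact: derive_continuous VdV.
  by move=> s; rewrite /V gp Ap.
have est := critical_estimate tau0 (derivative_at_max VdV cmax).
rewrite -/(g c) in est.
(* The estimate at the maximum reaches every time: coercivity bounds [V t] below, Young's inequality
   bounds [V c] above. *)
have V1 : a * dot (g t) (g t) <= V t by exact: Age.
have V2 : 2 * V c <= (1 + k) * dot (g c) (g c).
  by have := dot_young (g c) (A c *m g c); have := Ale c (g c); rewrite /V; lra.
have gc0 := dot_ge0 (g c); have gc1 : 0 <= (1 + k) * dot (g c) (g c) by rewrite
  mulr_ge0 // addr_ge0.
have V3 : a * dot (g t) (g t) <= (1 + k) * dot (g c) (g c) by have := cmax t; lra.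
have s0 : 0 <= 2 * tau * a ^+ 3 - slow_cost by rewrite subr_ge0.
apply: (@le_trans _ _ ((2 * tau * a ^+ 3 - slow_cost) * ((1 + k) * dot (g c) (g c)))).
  by rewrite -/(g t) mulrAC -[X in X <= _]mulrC ler_wpM2l.
rewrite mulrCA -(mulrA (1 + k)) ler_wpM2l ?addr_ge0 //; apply: le_trans est _.
by rewrite ler_wpM2l // slow_cost_ge0.
Qed.

Lemma slow_manifold_hom tau (w : R -> 'cV[R]_r) : slow_cost < 2 * tau * a ^+ 3 ->
  periodic w -> has_derivative_mx w (fun t => - tau *: (A t *m (G t *m w t))) ->
  forall t, w t = 0.
Proof.
move=> tauk wp dw t.
have a3 : 0 < a ^+ 3 by rewrite exprn_gt0.
have tau0 : 0 <= tau.
  have := le_lt_trans slow_cost_ge0 tauk; rewrite pmulr_lgt0 // pmulr_rgt0 //.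
  exact: ltW.
have zp : periodic (fun _ : R => 0 : 'cV[R]_r) by [].
have dz := has_derivative_mx_cst (0 : 'cV[R]_r).
have d0 : dot (0 : 'cV[R]_r) 0 = 0 by rewrite /dot mulmx0 mxE.
have := @slow_manifold_bound tau (fun=> 0) (fun=> 0) w 0 tau0 (ltW tauk) zp dz _ wp _ t.
rewrite addr0 mulr0 => H; apply: dot_le0; rewrite -(pmulr_rle0 _ a0).
apply: le_trans (Gge t (w t)) _.
suff -> : G t *m w t = 0 by rewrite /dot mulmx0 mxE.
apply: dot_le0; rewrite -(pmulr_rle0 _ (mulr_gt0 a0 _ : 0 < a * (2 * tau * a ^+ 3 -
  slow_cost))) ?subr_gt0 //.
apply: H => [s|i j s]; first by rewrite d0 addr0.
by rewrite addr0; exact: dw.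
Qed.

Lemma slow_manifold_exists tau (b db : R -> 'cV[R]_r) : slow_cost < 2 * tau * a ^+ 3 ->
  periodic b -> has_derivative_mx b db ->
  exists2 y, periodic y &
    has_derivative_mx y (fun t => - tau *: (A t *m (G t *m y t + b t))).
Proof.
move=> tauk bp bdb.
have cZ p (Y dY : R -> 'M[R]_(r, p)) : has_derivative_mx Y dY -> continuous_mx (fun t
  => - tau *: (A t *m Y t)).
  by move=> YdY; exact: has_derivative_mx_continuous (has_derivative_mxZ (- tau)
    (has_derivative_mulmx AdA YdY)).
have [||w wp dw|y yp dy] := @periodic_linear_ode R r (fun t => - tau *: (A t *m G t))
  (fun t => - tau *: (A t *m b t)) (cZ _ _ _ GdG) (cZ _ _ _ bdb).
- by move=> t; rewrite Ap Gp.
- by move=> t; rewrite Ap bp.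
- apply: slow_manifold_hom tauk wp _ => i j t.
  by have := dw i j t; rewrite -scalemxAl mulmxA.
exists y => // i j t; have := dy i j t.
by rewrite -scalemxAl -scalerDr -mulmxA -mulmxDr.
Qed.

End SlowManifold.

(** * The master equation *)

Section Weights.
Variable R : realType.

(** Linearity is asked in the form that a difference quotient uses, so coordinate projections can be
    given as plain functions. *)
Lemma is_derive_continuous_linear (V W : normedModType R) (L : V -> W) (f : R -> V) t
  df :
  (forall a x y, L (a *: (x - y)) = a *: (L x - L y)) -> continuous L ->
  is_derive t (1 : R) f df -> is_derive t (1 : R) (L \o f) (L df).
Proof.
move=> Llin Lc [fd fE].
have Lcvg : h^-1 *: ((L \o f) (h *: (1 : R) + t) - (L \o f) t) @[h --> 0^'] --> L df.
  have -> : (fun h : R => h^-1 *: ((L \o f) (h *: (1 : R) + t) - (L \o f) t)) =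
     L \o (fun h : R => h^-1 *: (f (h *: (1 : R) + t) - f t)).
    by apply/funext => h; rewrite /= Llin.
  by apply: cvg_comp; [exact: fd|rewrite -fE; exact: Lc].
by apply: DeriveDef; [apply/cvg_ex; exists (L df)|exact: cvg_lim Lcvg].
Qed.

Lemma periodic_derivative (f df : R -> R) :
  periodic f -> has_derivative f df -> periodic df.
Proof.
move=> fp fdf t.
have := @is_derive1_comp _ _ (shift 1) t _ _ (fdf (t + 1)) (is_derive_shift t (1 : R)
  1).
have -> : f \o shift 1 = f by apply/funext => s; exact: fp.
by rewrite mulr1 => -[_ <-]; have [_ ->] := fdf t.
Qed.

Lemma exp_diag_derivative k (F : R -> 'rV[R]_k) (dF : 'I_k -> R -> R) c :
  periodic F -> (forall j, has_derivative (fun t => F t 0 j) (dF j)) ->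
  (forall j, continuous (dF j)) ->
  exists dD, [/\ has_derivative_mx (fun t => exp_diag c (F t)) dD,
    continuous_mx dD & periodic dD].
Proof.
move=> Fp FdF dFc.
exists (fun t => diag_mx (\row_j (c * dF j t * expR (c * F t 0 j)))).
have FE j : has_derivative (fun t => expR (c * F t 0 j)) (fun t => c * dF j t * expR (c
  * F t 0 j)).
  move=> t; have := @is_derive1_comp _ expR (c \*: (fun t => F t 0 j)) t _ _
    (is_derive_expR (c * F t 0 j)) (is_deriveZ c (FdF j t)).
  by rewrite mulrC.
split=> [i j|i j|t].
- have [<-|ij] := eqVneq i j.
    by move=> t; rewrite !mxE eqxx mulr1n; congr is_derive: (FE i t);
      apply/funext => s; rewrite !mxE eqxx mulr1n.
  move=> t; rewrite !mxE (negPf ij) mulr0n;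
    congr is_derive: (is_derive_cst (0 : R) t (1 : R)).
  by apply/funext => s; rewrite !mxE (negPf ij) mulr0n.
- under eq_fun do rewrite !mxE.
  have [_|_] := eqVneq i j; last by under eq_fun do rewrite mulr0n;
    exact: cst_continuous.
  under eq_fun do rewrite mulr1n.
  move=> t; apply: (@continuousM _ _ (fun s => c * dF i s) (fun s => expR (c * F s 0
    i))).
    apply: (@continuousM _ _ (fun=> c) (dF i)); [exact: cst_continuous|exact: dFc].
  exact: (derive_continuous (FE i)).
- have dFp j : periodic (dF j) by apply: (periodic_derivative _ (FdF j)) => s;
  rewrite Fp.
  by rewrite Fp; congr diag_mx; apply/matrixP => i j; rewrite !mxE dFp.
Qed.

Lemma exp_diag_lower k (F : R -> 'rV[R]_k) c : continuous_mx F -> periodic F ->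
  exists2 m, 0 < m & forall t j, m <= expR (c * F t 0 j).
Proof.
move=> Fc Fp; have [K FK] := periodic_bounded_mx Fc Fp.
exists (expR (- (`|c| * K))); first exact: expR_gt0.
move=> t j; rewrite ler_expR lerNl; apply: le_trans (ler_norm _) _.
by rewrite normrN normrM ler_wpM2l.
Qed.

(** The left inverse gives [|x|^2 <= c |P x|^2], and the weights are at least [e0]. Since [a]
    depends on the weights only through [e0], it is uniform in time; the [+ 1] keeps its denominator
    positive. *)
Lemma gram_coercive m r (P : 'M[R]_(m, r)) (P' : 'M[R]_(r, m)) (e0 : R) :
  P' *m P = 1%:M -> 0 < e0 ->
  exists2 a, 0 < a & forall e : 'rV[R]_m, (forall j, e0 <= e 0 j) ->
    forall x, a * dot x x <= dot x (P^T *m diag_mx e *m P *m x).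
Proof.
move=> P'P e00.
have [c c0 hc] := dot_mulmx_bound r m (\sum_i \sum_j `|P' i j|).
exists (e0 / (c + 1)); first by rewrite divr_gt0 // ltr_wpDl.
move=> e ee x; rewrite {2}/dot gram_form.
apply: (@le_trans _ _ (e0 * dot (P *m x) (P *m x))).
  rewrite -mulrA ler_pM2l // mulrC ler_pdivrMr ?ltr_wpDl // mulrC mulrDl mul1r.
  rewrite -{1 2}[x]mul1mx -P'P -!mulmxA.
  have : dot (P' *m (P *m x)) (P' *m (P *m x)) <= c * dot (P *m x) (P *m x).
    by apply: hc; exact: normr_entry_le_sum.
  by have := dot_ge0 (P *m x); lra.
rewrite dotE mulr_sumr; apply: ler_sum => j _.
by rewrite -expr2 ler_wpM2r // sqr_ge0.
Qed.

End Weights.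

Section SmoothParameters.
Variable R : realType.

Lemma smooth_functional (V : normedModType R) (f : R -> V) (L : V -> R) :
  (forall a x y, L (a *: (x - y)) = a * (L x - L y)) -> continuous L -> smooth f ->
  exists dL, has_derivative (fun t => L (f t)) dL /\ continuous dL.
Proof.
move=> Llin Lc fs.
(* The second derivative serves to make the first one continuous. *)
have f1 t : is_derive t (1 : R) f (derive1n 1 f t).
  by rewrite [derive1n 1 f]/= derive1E; apply: derivableP; exact: (fs 0%N).
have f2 t : is_derive t (1 : R) (derive1n 1 f) (derive1n 2 f t).
  by rewrite [derive1n 2 f]/= derive1E; apply: derivableP; exact: (fs 1%N).
exists (L \o derive1n 1 f); split.
  by move=> t; exact: (is_derive_continuous_linear Llin Lc (f1 t)).
apply: (@derive_continuous _ _ (L \o derive1n 2 f)) => t.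
exact: (is_derive_continuous_linear Llin Lc (f2 t)).
Qed.

Variables (n : nat) (X : finite_cw R n.+1).
Variables (gamma : R -> parameters X).
Hypothesis gamma_smooth : smooth gamma.

Lemma smooth_fst j : exists dF,
  has_derivative (fun t => (gamma t).1 0 j) dF /\ continuous dF.
Proof.
apply: (@smooth_functional _ gamma (fun p => p.1 0 j)) => [a x y|p|].
- by rewrite !mxE.
- apply: (@continuous_comp _ _ _ (fun p : parameters X => p.1) (fun M => M 0 j)).
    exact: cvg_fst.
  exact: coord_continuous.
- exact: gamma_smooth.
Qed.

Lemma smooth_snd j : exists dF,
  has_derivative (fun t => (gamma t).2 0 j) dF /\ continuous dF.
Proof.
apply: (@smooth_functional _ gamma (fun p => p.2 0 j)) => [a x y|p|].
- by rewrite !mxE.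
- apply: (@continuous_comp _ _ _ (fun p : parameters X => p.2) (fun M => M 0 j)).
    exact: cvg_snd.
  exact: coord_continuous.
- exact: gamma_smooth.
Qed.

End SmoothParameters.

Section MasterEquation.
Variables (R : realType) (n : nat) (X : finite_cw R n.+1).
Variables (r : nat) (P : 'M[int]_(ncell X n, r)) (Q : 'M[int]_(r, ncell X n.+1)).
Variables (Q' : 'M[int]_(ncell X n.+1, r)) (P' : 'M[rat]_(r, ncell X n)).
Hypothesis incE : cw_incidence X n = P *m Q.
Hypothesis QQ' : Q *m Q' = 1%:M.
Hypothesis P'P : P' *m map_mx intr P = 1%:M.
Variables (beta : R) (gamma : R -> parameters X).
Hypothesis gamma_smooth : smooth gamma.
Hypothesis gamma_periodic : periodic gamma.

Local Notation PR := (map_mx intr P : 'M[R]_(ncell X n, r)).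
Local Notation QR := (map_mx intr Q : 'M[R]_(r, ncell X n.+1)).
Local Notation LR := (map_mx ratr P' : 'M[R]_(r, ncell X n)).
Local Notation D t := (exp_diag beta (gamma t).1).
(** The double transpose presents this as a Gram matrix of [QR^T], whose left inverse comes from
    [Q'], so [gram_coercive] applies to it as it does to [weighted_gram]. *)
Definition mobility t : 'M[R]_r := QR^T^T *m exp_diag (- beta) (gamma t).2 *m QR^T.
Definition weighted_gram t : 'M[R]_r := PR^T *m D t *m PR.
Local Notation A := mobility.
Local Notation G := weighted_gram.

Lemma master_op_factor t (q : 'cV[R]_(ncell X n)) :
  master_op beta (gamma t) *m q = PR *m (A t *m (PR^T *m D t *m q)).
Proof.
by rewrite /master_op (bd_factor incE) trmx_mul /A trmxK -!mulmxA.
Qed.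

Section Class.
Variable z0 : 'cV[int]_(ncell X n).
Local Notation z := (map_mx intr z0 : 'cV[R]_(ncell X n)).
Local Notation b t := (PR^T *m D t *m z).

Lemma weighted_coordinates t (y : 'cV[R]_r) :
  PR^T *m D t *m (z + PR *m y) = G t *m y + b t.
Proof. by rewrite /G mulmxDr mulmxA addrC. Qed.

Lemma solution_of_coordinates tau y : periodic y ->
  has_derivative_mx y (fun t => - tau *: (A t *m (G t *m y t + b t))) ->
  periodic_solution beta gamma z0 tau (fun t => z + PR *m y t).
Proof.
move=> yp dy; split=> [t|t|].
- by rewrite yp.
- by apply/hclass_full; rewrite addrC addKr; apply/(boundaryP incE QQ'); exists (y t).
apply/has_derivative_mxP => i j t.
have := has_derivative_mxD (has_derivative_mx_cst z)
  (has_derivative_mulmx (has_derivative_mx_cst PR) dy) i j t.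
by rewrite mul0mx !add0r master_op_factor weighted_coordinates -scalemxAr.
Qed.

Lemma coordinates_of_solution tau q : periodic_solution beta gamma z0 tau q ->
  exists2 y, periodic y &
    (forall t, q t = z + PR *m y t) /\
    has_derivative_mx y (fun t => - tau *: (A t *m (G t *m y t + b t))).
Proof.
case=> qp qz /has_derivative_mxP dq.
have LP : LR *m PR = 1%:M by exact: left_inverse.
have qE t : q t = z + PR *m (LR *m (q t - z)).
  have /hclass_full/(boundaryP incE QQ')[y e] := qz t.
  by rewrite e (mulmxA LR) LP mul1mx -e addrC subrK.
exists (fun t => LR *m (q t - z)); first by move=> t; rewrite qp.
split=> // i j t.
have := has_derivative_mulmx (has_derivative_mx_cst LR)
  (has_derivative_mxD dq (has_derivative_mx_cst (- z))) i j t.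
have -> : master_op beta (gamma t) *m q t =
    PR *m (A t *m (G t *m (LR *m (q t - z)) + b t)).
  by rewrite master_op_factor {1}[q t]qE weighted_coordinates.
by rewrite mul0mx add0r addr0 -scalemxAr (mulmxA LR) LP mul1mx.
Qed.

End Class.

(** Continuity and periodicity give bounds valid at all times. None involves the homology class, so
    the threshold depends on [beta] and [gamma] only. *)
Lemma master_constants : exists a k dA dG,
  [/\ 0 < a, 0 <= k, has_derivative_mx A dA, has_derivative_mx G dG &
   (forall t x, a * dot x x <= dot x (A t *m x)) /\
   (forall t x, a * dot x x <= dot x (G t *m x)) /\
   (forall t x, dot (A t *m x) (A t *m x) <= k * dot x x) /\
   (forall t x, dot (dA t *m x) (dA t *m x) <= k * dot x x) /\
   (forall t x, dot (dG t *m x) (dG t *m x) <= k * dot x x)].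
Proof.
have [dE dEP] := choice (smooth_fst gamma_smooth).
have [dW dWP] := choice (smooth_snd gamma_smooth).
have Ep : periodic (fun t => (gamma t).1) by move=> t; rewrite gamma_periodic.
have Wp : periodic (fun t => (gamma t).2) by move=> t; rewrite gamma_periodic.
have [dDE [DdE dEc dEp]] := exp_diag_derivative beta Ep (fun j => (dEP j).1) (fun j =>
  (dEP j).2).
have [dDW [DdW dWc dWp]] := exp_diag_derivative (- beta) Wp (fun j => (dWP j).1) (fun j
  => (dWP j).2).
have Ec : continuous_mx (fun t => (gamma t).1).
  by move=> i j; rewrite ord1; exact: derive_continuous (dEP j).1.
have Wc : continuous_mx (fun t => (gamma t).2).
  by move=> i j; rewrite ord1; exact: derive_continuous (dWP j).1.
have [e0 e00 Ee] := exp_diag_lower beta Ec Ep.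
have [w0 w00 Ww] := exp_diag_lower (- beta) Wc Wp.
have QL : (map_mx intr Q')^T *m QR^T = 1%:M by rewrite -trmx_mul -map_mxM QQ' map_mx1
  trmx1.
have LP : LR *m PR = 1%:M by exact: left_inverse.
have [aG aG0 hG] := gram_coercive LP e00.
have [aA aA0 hA] := gram_coercive QL w00.
have conj m l (B : 'M[R]_(m, l)) (S dS : R -> 'M[R]_m) : has_derivative_mx S dS ->
    has_derivative_mx (fun t => B^T *m S t *m B) (fun t => B^T *m dS t *m B).
  move=> SdS i j t; have := has_derivative_mulmx
    (has_derivative_mulmx (has_derivative_mx_cst B^T) SdS) (has_derivative_mx_cst B) i
      j t.
  by rewrite mul0mx add0r mulmx0 addr0.
have cconj m l (B : 'M[R]_(m, l)) (S : R -> 'M[R]_m) : continuous_mx S ->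
    continuous_mx (fun t => B^T *m S t *m B).
  move=> Sc; apply: continuous_mulmx; last by move=> i j; exact: cst_continuous.
  by apply: continuous_mulmx => //; move=> i j; exact: cst_continuous.
have bdd (S : R -> 'M[R]_r) : continuous_mx S -> periodic S -> exists2 c, 0 <= c &
    forall t x, dot (S t *m x) (S t *m x) <= c * dot x x.
  move=> Sc Sp; have [K SK] := periodic_bounded_mx Sc Sp.
  by have [c c0 hc] := dot_mulmx_bound r r K; exists c => // t; exact: hc.
have AdA := conj _ _ QR^T _ _ DdW.
have GdG := conj _ _ PR _ _ DdE.
have [k1 k10 h1] := bdd _ (has_derivative_mx_continuous AdA) (fun t => congr1 (fun p =>
  QR^T^T *m exp_diag (- beta) p *m QR^T) (Wp t)).
have [k2 k20 h2] := bdd _ (cconj _ _ QR^T _ dWc) (fun t => congr1 (fun p => QR^T^T *m p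
  *m QR^T) (dWp t)).
have [k3 k30 h3] := bdd _ (cconj _ _ PR _ dEc) (fun t => congr1 (fun p => PR^T *m p *m
  PR) (dEp t)).
have lek u v s (x : 'cV[R]_r) : u <= v -> s <= u * dot x x -> s <= v * dot x x.
  by move=> uv /le_trans; apply; rewrite ler_wpM2r // dot_ge0.
have gek u v s (x : 'cV[R]_r) : v <= u -> u * dot x x <= s -> v * dot x x <= s.
  by move=> uv; apply: le_trans; rewrite ler_wpM2r // dot_ge0.
exists (Num.min aA aG), (k1 + k2 + k3), (fun t => QR^T^T *m dDW t *m QR^T),
  (fun t => PR^T *m dDE t *m PR); split; [| |exact: AdA|exact: GdG|].
- by rewrite lt_min aA0 aG0.
- by rewrite !addr_ge0.
split; [|split; [|split; [|split]]] => t x.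
- apply: (gek aA); first by rewrite ge_min lexx.
  by apply: hA => j; rewrite mxE; exact: Ww.
- apply: (gek aG); first by rewrite ge_min lexx orbT.
  by apply: hG => j; rewrite mxE; exact: Ee.
- by apply: (lek k1) (h1 t x); lra.
- by apply: (lek k2) (h2 t x); lra.
- by apply: (lek k3) (h3 t x); lra.
Qed.

Lemma master_symmetric t : (A t)^T = A t.
Proof. by rewrite /A !trmx_mul !trmxK tr_diag_mx mulmxA. Qed.

Lemma master_A_periodic : periodic A.
Proof. by move=> t; rewrite /A gamma_periodic. Qed.

Lemma master_G_periodic : periodic G.
Proof. by move=> t; rewrite /G gamma_periodic. Qed.

Lemma master_b_derivative (z : 'cV[R]_(ncell X n)) : exists db,
  [/\ periodic (fun t => PR^T *m D t *m z),
      has_derivative_mx (fun t => PR^T *m D t *m z) db &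
      exists M, forall t, dot (PR^T *m D t *m z) (PR^T *m D t *m z) + dot (db t) (db t)
        <= M].
Proof.
have [dE dEP] := choice (smooth_fst gamma_smooth).
have Ep : periodic (fun t => (gamma t).1) by move=> t; rewrite gamma_periodic.
have [dDE [DdE dEc dEp]] := exp_diag_derivative beta Ep (fun j => (dEP j).1) (fun j =>
  (dEP j).2).
have bdb : has_derivative_mx (fun t => PR^T *m D t *m z) (fun t => PR^T *m dDE t *m z).
  move=> i j t; have := has_derivative_mulmx
    (has_derivative_mulmx (has_derivative_mx_cst PR^T) DdE) (has_derivative_mx_cst z) i
      j t.
  by rewrite mul0mx add0r mulmx0 addr0.
have bp : periodic (fun t => PR^T *m D t *m z) by move=> t; rewrite gamma_periodic.
exists (fun t => PR^T *m dDE t *m z); split=> //.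
have dbc : continuous_mx (fun t => PR^T *m dDE t *m z).
  apply: continuous_mulmx; last by move=> i j; exact: cst_continuous.
  by apply: continuous_mulmx => //; move=> i j; exact: cst_continuous.
have dotc (S : R -> 'cV[R]_r) : continuous_mx S -> continuous (fun t => dot (S t) (S
  t)).
  move=> Sc; apply: (@continuous_mulmx _ _ _ _ (fun t => (S t)^T) S) => // i j.
  by under eq_fun do rewrite mxE; exact: Sc.
have [M1 h1] := periodic_bounded (dotc _ (has_derivative_mx_continuous bdb)) (fun t =>
  congr1 (fun x => dot x x) (bp t)).
have [M2 h2] := periodic_bounded (dotc _ dbc) (fun t => congr1 (fun x => dot (PR^T *m x
  *m z) (PR^T *m x *m z)) (dEp t)).
exists (M1 + M2) => t; apply: lerD; first exact: le_trans (ler_norm _) (h1 t).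
exact: le_trans (ler_norm _) (h2 t).
Qed.

(** By [boltzmannE] the limit is the point with [g = 0], so [rho tau] differs from it by [K g] with
    [K = P G^-1]. At fixed [t] this [K] is constant, and the bound on [|g|^2] decays like
    [1 / tau]. *)
Lemma boltzmann_limit z0 t (a k s : R) (rho : R -> 'cV[R]_(ncell X n)) (tau0 : R) :
  0 < a -> rel_cycles int (all_cells X) (no_cells X) n z0 ->
  (forall tau, tau0 < tau -> exists2 y, rho tau = map_mx intr z0 + PR *m y &
    a * (2 * tau * a ^+ 3 - s) * dot (G t *m y + PR^T *m D t *m map_mx intr z0)
       (G t *m y + PR^T *m D t *m map_mx intr z0) <= k) ->
  rho tau @[tau --> +oo] -->
    boltzmann beta (gamma t).1 (hclass (all_cells X) (no_cells X) n z0).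
Proof.
move=> a0 Zz0 H; rewrite (boltzmannE incE QQ' P'P) // -/(G t).
have Gu : G t \in unitmx by exact: (weighted_gram_unit P'P).
pose K : 'M[R]_(ncell X n, r) := PR *m invmx (G t).
have [c c0 hc] := dot_mulmx_bound (ncell X n) r (\sum_i \sum_j `|K i j|).
have {}hc := hc _ (normr_entry_le_sum K).
apply/cvgrPdist_le => e e0; near=> tau.
have tau0tau : tau0 < tau by near: tau; apply: nbhs_pinfty_gt; rewrite num_real.
have [y -> ky] := H tau tau0tau.
set b := PR^T *m D t *m _ in ky *; set g := _ + b in ky.
have -> : map_mx intr z0 - PR *m (invmx (G t) *m b) - (map_mx intr z0 + PR *m y) = - (K
  *m g).
  rewrite /K /g -mulmxA [invmx _ *m (_ + _)]mulmxDr mulKmx // mulmxDr.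
  by rewrite opprD addrACA subrr add0r opprD addrC.
rewrite normrN [leLHS]/Num.Def.normr /= mx_normrE (bigmax_le _ (ltW e0)) //= => -[i j]
  _ /=.
rewrite ord1 -(@ler_pXn2r _ 2) ?nnegrE ?(ltW e0) // real_normK ?num_real //.
apply: le_trans (sqr_le_dot _ _) _; apply: le_trans (hc g) _.
have a2 : 0 < 2 * a ^+ 3 by rewrite mulr_gt0 // exprn_gt0.
(* Makes [S] at least [c |k| / (a e^2) + 1]; the [+ 1] keeps [S] positive when [c |k|] vanishes. *)
have big : c * `|k| / (a * e ^+ 2) + s + 1 <= 2 * tau * a ^+ 3.
  have -> : 2 * tau * a ^+ 3 = tau * (2 * a ^+ 3) by ring.
  by rewrite -ler_pdivrMr //.
set S := 2 * tau * a ^+ 3 - s in ky.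
have ae : 0 < a * e ^+ 2 by rewrite mulr_gt0 // exprn_gt0.
have h1 : c * `|k| <= S * (a * e ^+ 2) by rewrite -ler_pdivrMr // /S; lra.
have S0 : 0 < a * S.
  have : 0 <= c * `|k| / (a * e ^+ 2) by rewrite divr_ge0 ?mulr_ge0 // ltW.
  by rewrite pmulr_rgt0 // /S; lra.
rewrite -(ler_pM2l S0) mulrCA.
apply: le_trans (ler_wpM2l c0 (le_trans ky (ler_norm _))) _.
by apply: le_trans h1 _; rewrite mulrCA mulrA.
Unshelve. all: by end_near. Qed.

End MasterEquation.

Theorem theorem2 (R : realType) (n : nat) (X : finite_cw R n.+1)
    (X_connected : connected [set: X])
    (beta : R) (beta_gt0 : 0 < beta)
    (gamma : R -> parameters X)
    (gamma_smooth : smooth gamma) (gamma_periodic : periodic gamma) :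
  exists tau0 : R, 0 < tau0 /\
    forall z0 : 'cV[int]_(ncell X n), rel_cycles int (all_cells X) (no_cells X) n z0 ->
      (forall tau, tau0 < tau ->
         exists! rho, periodic_solution beta gamma z0 tau rho) /\
      (forall rho : R -> R -> 'cV[R]_(ncell X n),
         (forall tau, tau0 < tau ->
            periodic_solution beta gamma z0 tau (rho tau)) ->
         forall t, rho tau t @[tau --> +oo] -->
           boltzmann beta (gamma t).1 (hclass (all_cells X) (no_cells X) n z0)).
Proof.
have [r [P [Q [Q' [P' [incE QQ' P'P]]]]]] := lattice_factor (cw_incidence X n).
have [a [k [dA [dG [a0 k0 AdA GdG [hA [hG [kA [kdA kdG]]]]]]]]] :=
  master_constants QQ' P'P beta gamma_smooth gamma_periodic.
have Asym := master_symmetric Q beta gamma.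
have Ap := master_A_periodic Q beta gamma_periodic.
have Gp := master_G_periodic P beta gamma_periodic.
pose s := slow_cost a k.
have s0 : 0 <= s := slow_cost_ge0 a0 k0.
have a3 : 0 < 2 * a ^+ 3 by rewrite mulr_gt0 // exprn_gt0.
(* Beyond [s / (2 a^3)] the fast term [2 tau a^3] dominates [s]; adding 1 makes positivity
   immediate. The choice precedes [z0]. *)
exists (s / (2 * a ^+ 3) + 1); split; first by rewrite ltr_wpDl // divr_ge0 // ltW.
move=> z0 Zz0.
have tau_big tau : s / (2 * a ^+ 3) + 1 < tau -> s < 2 * tau * a ^+ 3.
  move=> st; rewrite mulrAC mulrC -ltr_pdivrMr //; lra.
have [db [bp bdb [M bM]]] := master_b_derivative P beta gamma_smooth gamma_periodic
  (map_mx intr z0).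
split=> [tau /tau_big st|rho rhoP t].
  have [y yp dy] := slow_manifold_exists a0 k0 AdA GdG Asym hA hG kA kdA kdG Ap Gp st
    bp bdb.
  exists (fun t => map_mx intr z0 + map_mx intr P *m y t); split.
    exact: (solution_of_coordinates incE QQ' yp dy).
  move=> q /(coordinates_of_solution incE QQ' P'P)[y' yp' [qE dy']].
  apply/funext => t; rewrite qE; congr (_ + _ *m _); apply/eqP; rewrite -subr_eq0;
    apply/eqP.
  (* The inhomogeneous terms cancel in [y - y'], leaving a periodic solution of the homogeneous
     equation. *)
  apply: (slow_manifold_hom (w := fun t => y t - y' t) a0 k0 AdA GdG Asym hA hG kA kdA
    kdG Ap Gp st).
    by move=> u; rewrite yp yp'.
  move=> i j u; have := has_derivative_mxD dy (has_derivative_mxZ (-1) dy') i j u.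
  congr is_derive; first by apply/funext => v; rewrite scaleN1r.
  rewrite scaleN1r -scalerBr -mulmxBr; congr ((_ *: (_ *m _)) _ _).
  by rewrite opprD addrACA subrr addr0 -mulmxBr.
apply: (boltzmann_limit (rho := fun tau => rho tau t) (k := (1 + k) * s * M) (s := s)
  (tau0 := s / (2 * a ^+ 3) + 1) incE QQ' P'P a0 Zz0) => tau st.
have [y yp [qE dy]] := coordinates_of_solution incE QQ' P'P (rhoP tau st).
exists (y t); first exact: qE.
apply: (slow_manifold_bound a0 k0 AdA GdG Asym hA hG kA kdA kdG Ap Gp _ (ltW (tau_big _
  st)) bp bdb bM yp dy).
have : 0 <= s / (2 * a ^+ 3) by rewrite divr_ge0 // ltW.
lra.
Qed.
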